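(* Fix an integer $h\ge2$ and let $\{G_n\}_{n\ge1}$ be a sequence of finite digraphs with $n_1(n):=|V(G_n)|\to\infty$. Let $v_n^\ast$ be uniform in $V(G_n)$ and suppose that $(G_n,v_n^\ast)$ converges in distribution, in the local metric $d_{\mathrm{loc}}$, to a random rooted digraph $(G^\ast,r^\ast)$ with root $r^\ast$. Write $D_n:=\deg_{\mathrm{in}}(v_n^\ast)+\deg_{\mathrm{out}}(v_n^\ast)$ for the total degree of $v_n^\ast$ in $G_n$ and $D_\ast$ for the total degree of $r^\ast$ in $G^\ast$. Assume $\mathbb E[D_\ast^{h-1}]<\infty$. Then the following are equivalent: (i) $\mathbb E[D_n^{h-1}]\to\mathbb E[D_\ast^{h-1}]$ as $n\to\infty$. (ii) The family $\{D_n^{h-1}\}_{n\ge1}$ is uniformly integrable. (iii) For every connected digraph $H$ on $h$ vertices and every rooted version $H^\bullet\in\mathcal R(H)$, $$n_1(n)^{-1}\,\mathrm{emb}(H,G_n)\longrightarrow\mathbb E[\mathrm{emb}^\bullet(H^\bullet,G^\ast,r^\ast)]\qquad\text{as }n\to\infty.$$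
   Context: Digraphs are directed, simple and loopless: at most one arc for each ordered pair of distinct vertices (opposite arcs are allowed). Connectedness refers to the underlying undirected graph. $\mathcal G^\to_\ast$ is the space of rooted, connected, locally finite (possibly infinite) digraphs modulo rooted digraph isomorphism. The radius-$r$ ball of a rooted digraph is the induced subdigraph, rooted at the same vertex, on the vertices within undirected distance $\le r$ of the root. $d_{\mathrm{loc}}$ is the standard local metric, e.g. $d_{\mathrm{loc}}((G,v),(G',v'))=1/(1+R)$, where $R$ is the supremum of those $r\ge 0$ for which the radius-$r$ balls are isomorphic as rooted digraphs; convergence in distribution in $d_{\mathrm{loc}}$ is equivalent to convergence, for each $r$ and each finite rooted digraph $F$, of the probability that the radius-$r$ ball is isomorphic to $F$. A finite digraph $G$ with root $v$ is viewed as an element of $\mathcal G^\to_\ast$ via the connected component of $v$. The limit $(G^\ast,r^\ast)$ is a random element of $\mathcal G^\to_\ast$. The graphs $G_n$ are deterministic and the randomness of $(G_n,v_n^\ast)$ comes from $v_n^\ast$. $\mathrm{emb}(H,G)$ is the number of injective digraph homomorphisms $V(H)\to V(G)$ (injective maps sending arcs to arcs, preserving direction). For a rooted digraph $F$ with root $r(F)$ and a rooted digraph $(G,v)$, $\mathrm{emb}^\bullet(F,G,v)$ is the number of injective homomorphisms $\varphi:V(F)\to V(G)$ with $\varphi(r(F))=v$. For an unrooted digraph $H$, $\mathcal R(H)$ is the set of rooted versions of $H$ obtained by choosing a root in $V(H)$. *)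

(* Defs.v *)
From HB Require Import structures.
From mathcomp Require Import all_boot all_order all_algebra generic_quotient finmap.
From mathcomp Require Import all_classical all_reals all_analysis.
Import Order.TTheory GRing.Theory Num.Theory.
Import numFieldNormedType.Exports.

Set Implicit Arguments.
Unset Strict Implicit.
Unset Printing Implicit Defensive.

Local Open Scope classical_set_scope.
Local Open Scope ring_scope.
Local Open Scope quotient_scope.

Record digraph := Digraph {
  vertex :> finType;
  arc : rel vertex;
  arc_irr : irreflexive arc }.

Definition deg_in (G : digraph) (v : G) : nat := #|[set u : G | arc u v]%SET|.

Definition deg_out (G : digraph) (v : G) : nat := #|[set u : G | arc v u]%SET|.

Definition deg (G : digraph) (v : G) : nat := (deg_in v + deg_out v)%N.

Definition uadj (G : digraph) : rel G := [rel x y | arc x y || arc y x].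

Definition connected_digraph (G : digraph) : Prop :=
  forall x y : G, connect (@uadj G) x y.

Definition emb (H G : digraph) : nat :=
  #|[set phi : {ffun H -> G} | injectiveb phi &&
      [forall x, forall y, arc x y ==> arc (phi x) (phi y)]]%SET|.

(* [walk e k x y]: there is a walk of length [k] from [x] to [y] in the
   undirected graph underlying the arc relation [e]. *)
Fixpoint walk (T : Type) (e : T -> T -> Prop) (k : nat) (x y : T) : Prop :=
  if k is k'.+1 then exists2 z, e x z \/ e z x & walk e k' z y else x = y.

(* A connected locally finite digraph has countably many vertices, so up to
   isomorphism its vertex set may be taken to be a set of natural numbers. *)
Record rdigraph := RDigraph {
  rvert : set nat;
  rarc : nat -> nat -> Prop;
  rroot : nat;
  rarc_irr : forall x, ~ rarc x x;
  rarc_vert : forall x y, rarc x y -> rvert x /\ rvert y;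
  rroot_vert : rvert rroot;
  rconnected : forall x, rvert x -> exists k, walk rarc k rroot x;
  rlocfin : forall x, finite_set [set y | rarc x y \/ rarc y x] }.

Definition ball_vert (G : rdigraph) (r : nat) : set nat :=
  [set x | exists2 k, (k <= r)%N & walk (rarc G) k (rroot G) x].

(* [f] is a rooted isomorphism from the subdigraph of [G] induced on [A] to the
   subdigraph of [G'] induced on [A']. *)
Definition is_iso_on (G G' : rdigraph) (A A' : set nat) (f : nat -> nat) : Prop :=
  [/\ set_bij A A' f, f (rroot G) = rroot G' &
      forall x y, A x -> A y -> (rarc G x y <-> rarc G' (f x) (f y))].

Definition iso_on (G G' : rdigraph) (A A' : set nat) : Prop :=
  exists f, is_iso_on G G' A A' f.

Definition riso (G G' : rdigraph) : Prop := iso_on G G' (rvert G) (rvert G').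

Definition ball_iso (r : nat) (G G' : rdigraph) : Prop :=
  iso_on G G' (ball_vert G r) (ball_vert G' r).

Definition rdeg_in (G : rdigraph) : nat :=
  #|` fset_set [set u | rarc G u (rroot G)]|.

Definition rdeg_out (G : rdigraph) : nat :=
  #|` fset_set [set u | rarc G (rroot G) u]|.

Definition rdeg (G : rdigraph) : nat := (rdeg_in G + rdeg_out G)%N.

Definition remb_set (F : digraph) (r : F) (G : rdigraph) :
    set {ffun F -> nat} :=
  [set phi : {ffun F -> nat} | [/\ injective phi, forall x, rvert G (phi x),
     forall x y, arc x y -> rarc G (phi x) (phi y) & phi r = rroot G]].

(* For connected [F] the set is finite, by local finiteness of [G];
   [fset_set] returns the empty set on infinite sets. *)
Definition remb (F : digraph) (r : F) (G : rdigraph) : nat :=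
  #|` fset_set (remb_set r G)|.

Section rooted_isomorphism.

Lemma iso_on_refl G A : iso_on G G A A.
Proof.
by exists id; split => //; split => // x Ax; exists x.
Qed.

Lemma iso_on_sym G G' A A' : A (rroot G) -> iso_on G G' A A' -> iso_on G' G A' A.
Proof.
move=> rA [f [[fA finj fsurj] fr farc]].
have [g gP] : {g : nat -> nat & forall y, A' y -> A (g y) /\ f (g y) = y}.
  apply: (@choice _ _ (fun y z => A' y -> A z /\ f z = y)) => y.
  have [A'y|nA'y] := pselect (A' y); last by exists 0%N.
  by have [x Ax <-] := fsurj _ A'y; exists x.
have gf x : A x -> g (f x) = x.
  by move=> Ax; have [Agf gfK] := gP _ (fA _ Ax); apply: finj; rewrite ?inE.
exists g; split.
- split => [y /gP[]//|y y'|x Ax].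
  + rewrite !inE => /gP[_ e] /gP[_ e'] gg; by rewrite -e gg e'.
  + by exists (f x); [exact: fA|exact: gf].
- by rewrite -fr gf.
- move=> x y /gP[Agx ex] /gP[Agy ey]; rewrite -{1}ex -{1}ey.
  by apply: iff_sym; exact: farc.
Qed.

Lemma iso_on_trans G1 G2 G3 A1 A2 A3 :
  iso_on G1 G2 A1 A2 -> iso_on G2 G3 A2 A3 -> iso_on G1 G3 A1 A3.
Proof.
move=> [f [[fA finj fsurj] fr farc]] [g [[gA ginj gsurj] gr garc]].
exists (g \o f); split.
- split => [x Ax|x x'|z /gsurj[y /fsurj[x Ax <-] <-]].
  + by apply: gA; exact: fA.
  + rewrite !inE => Ax Ax' /= e; apply: finj; rewrite ?inE//.
    by apply: ginj; rewrite ?inE//; exact: fA.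
  + by exists x.
- by rewrite /= fr.
- move=> x y Ax Ay; apply: (iff_trans (farc x y Ax Ay)).
  by apply: garc; exact: fA.
Qed.

Lemma walkSr (T : Type) (e : T -> T -> Prop) k x y :
  walk e k.+1 x y <-> exists2 z, walk e k x z & e z y \/ e y z.
Proof.
elim: k x => [|k IHk] x /=.
  split=> [[z xz <-]|[z <- zy]]; [by exists x|by exists y].
split=> [[z xz /IHk[t zt ty]]|[t [z xz zt] ty]].
  by exists t => //; exists z.
by exists z => //; apply/IHk; exists t.
Qed.

Lemma ball_vert_root G r : ball_vert G r (rroot G).
Proof. by exists 0%N. Qed.

Lemma ball_vertW G r s : (r <= s)%N -> ball_vert G r `<=` ball_vert G s.
Proof. by move=> rs x [k kr w]; exists k => //; exact: leq_trans rs. Qed.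

Lemma ball_vert_sub G r : ball_vert G r `<=` rvert G.
Proof.
move=> x [[|k] _]; first by move=> /= <-; exact: rroot_vert.
by move=> /walkSr[z _ [] /rarc_vert[]].
Qed.

Lemma is_iso_on_ball G G' A A' r f :
  ball_vert G r `<=` A -> ball_vert G' r `<=` A' -> is_iso_on G G' A A' f ->
  is_iso_on G G' (ball_vert G r) (ball_vert G' r) f.
Proof.
move=> rA rA' [[fA finj fsurj] fr farc].
have fwd k x : (k <= r)%N -> walk (rarc G) k (rroot G) x ->
    walk (rarc G') k (rroot G') (f x).
  elim: k x => [|k IHk] x kr; first by move=> /= <-; rewrite fr.
  move=> w; have Ax : A x by apply: rA; exists k.+1.
  move: w => /walkSr[z wz zx]; have Az : A z.
    by apply: rA; exists k => //; exact: ltnW.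
  apply/walkSr; exists (f z); first by apply: IHk => //; exact: ltnW.
  by case: zx => [/(farc _ _ Az Ax)|/(farc _ _ Ax Az)]; [left|right].
have bwd k y : (k <= r)%N -> walk (rarc G') k (rroot G') y ->
    exists2 x, walk (rarc G) k (rroot G) x & f x = y.
  elim: k y => [|k IHk] y kr; first by move=> /= <-; exists (rroot G).
  move=> w; have A'y : A' y by apply: rA'; exists k.+1.
  move: w => /walkSr[z' wz'].
  have [z wz <-] := IHk _ (ltnW kr) wz'.
  have Az : A z by apply: rA; exists k => //; exact: ltnW.
  have [x Ax <-] := fsurj _ A'y.
  move=> zx; exists x => //; apply/walkSr; exists z => //.
  by case: zx => [/(farc _ _ Az Ax)|/(farc _ _ Ax Az)]; [left|right].
split => //.
- split.
  + by move=> x [k kr w]; exists k => //; exact: fwd.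
  + by move=> x y; rewrite !inE => /rA Ax /rA Ay; apply: finj; rewrite inE.
  + move=> y [k kr /(bwd _ _ kr)[x w <-]]; exists x => //; by exists k.
- by move=> x y /rA Ax /rA Ay; exact: farc.
Qed.

Lemma iso_on_ball G G' A A' r : ball_vert G r `<=` A -> ball_vert G' r `<=` A' ->
  iso_on G G' A A' -> ball_iso r G G'.
Proof. by move=> rA rA' [f fP]; exists f; exact: is_iso_on_ball fP. Qed.

Lemma ball_iso_le r s G G' : (r <= s)%N -> ball_iso s G G' -> ball_iso r G G'.
Proof. by move=> rs; apply: iso_on_ball; exact: ball_vertW. Qed.

Lemma riso_ball_iso r G G' : riso G G' -> ball_iso r G G'.
Proof. by apply: iso_on_ball; exact: ball_vert_sub. Qed.

Lemma ball_iso0 G G' : ball_iso 0 G G'.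
Proof.
have b0 H x : ball_vert H 0 x -> x = rroot H by case=> -[|//] _ /= ->.
exists (fun=> rroot G'); split => //.
- split.
  + by move=> x _; exact: ball_vert_root.
  + by move=> x y; rewrite !inE => /b0 -> /b0 ->.
  + by move=> y /b0 ->; exists (rroot G) => //; exact: ball_vert_root.
- by move=> x y /b0 -> /b0 ->; split => /rarc_irr.
Qed.

Lemma ball_vert_finite G r : finite_set (ball_vert G r).
Proof.
have wf k : finite_set [set x | walk (rarc G) k (rroot G) x].
  elim: k => [|k IHk] /=.
    by rewrite (_ : [set x | _] = [set rroot G])//; apply/seteqP; split => x /= ->.
  apply: (@sub_finite_set _ _ (\bigcup_(z in [set x | walk (rarc G) k (rroot G) x])
     [set y | rarc G z y \/ rarc G y z])).
    by move=> y /walkSr[z wz zy]; exists z.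
  by apply: bigcup_finite => // z _; exact: rlocfin.
rewrite (_ : ball_vert G r = \bigcup_(k in `I_r.+1) [set x | walk (rarc G) k (rroot G) x]).
  by apply: bigcup_finite => //; exact: finite_II.
by apply/seteqP; split => x [k kr w]; exists k.
Qed.

Lemma rvert_ball G x : rvert G x -> exists r, ball_vert G r x.
Proof. by move=> /rconnected[k w]; exists k; exists k. Qed.

(* Compactness: the limit of the isomorphisms between balls along an
   ultrafilter. *)
Lemma ball_iso_riso G G' : (forall r, ball_iso r G G') -> riso G G'.
Proof.
move=> GG'; have [F FP] := choice GG'.
have [U [UU oU]] := ultraFilterLemma (F := \oo : set_system nat) _.
have large r : U [set n | (r <= n)%N] by apply: oU; exact: nbhs_infty_ge.
have lim (D : set nat) (Q : nat -> nat -> Prop) : finite_set D ->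
    U [set n | exists2 y, D y & Q n y] -> exists2 y, D y & U [set n | Q n y].
  move=> /finite_fsetP[X DX] UDQ; apply: contrapT => nQ.
  have UnQ : U (\bigcap_(y in [set` X]) [set n | ~ Q n y]).
    apply: filter_bigI => y yX.
    have [UQ|//] := in_ultra_setVsetC [set n | Q n y] UU.
    by exfalso; apply: nQ; exists y => //; rewrite DX.
  have [n [[y Dy Qny] nQn]] := filter_ex (filterI UDQ UnQ).
  by move: Dy; rewrite DX => /nQn; exact.
have Fr n r : (r <= n)%N ->
    is_iso_on G G' (ball_vert G r) (ball_vert G' r) (F n).
  by move=> rn; apply: is_iso_on_ball (FP n); exact: ball_vertW.
have [f fP] : {f : nat -> nat & forall x, rvert G x ->
    rvert G' (f x) /\ U [set n | F n x = f x]}.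
  apply: (@choice _ _ (fun x y => rvert G x -> rvert G' y /\ U [set n | F n x = y])).
  move=> x; have [/rvert_ball[r xr]|nx] := pselect (rvert G x); last by exists 0%N.
  have [|y y' Uy] := lim (ball_vert G' r) (fun n y => F n x = y)
    (ball_vert_finite _ _).
    apply: filterS (large r) => n rn; exists (F n x) => //.
    by have [[nA _ _] _ _] := Fr _ _ rn; exact: nA.
  by exists y => _; split => //; exact: ball_vert_sub y'.
have common x y : rvert G x -> rvert G y -> exists n r,
    [/\ (r <= n)%N, ball_vert G r x, ball_vert G r y, F n x = f x & F n y = f y].
  move=> xG yG; have [r xr] := rvert_ball xG; have [s ys] := rvert_ball yG.
  have [[_ Ux] [_ Uy]] := (fP _ xG, fP _ yG).
  have [n [[/= nx ny] nrs]] := filter_ex (filterI (filterI Ux Uy) (large (maxn r s))).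
  exists n, (maxn r s); split => //.
  - exact: ball_vertW (leq_maxl _ _) _ xr.
  - exact: ball_vertW (leq_maxr _ _) _ ys.
exists f; split.
- split.
  + by move=> x /fP[].
  + move=> x y; rewrite !inE => xG yG fxy.
    have [n [r [rn xr yr nx ny]]] := common _ _ xG yG.
    have [[_ ninj _] _ _] := Fr _ _ rn.
    by apply: ninj; rewrite ?inE// nx ny.
  + move=> y yG'; have [r yr] := rvert_ball yG'.
    have [|x xr Ux] := lim (ball_vert G r) (fun n x => F n x = y)
      (ball_vert_finite _ _).
      apply: filterS (large r) => n rn.
      by have [[_ _ nsurj] _ _] := Fr _ _ rn; have [x xr <-] := nsurj _ yr; exists x.
    have xG := ball_vert_sub xr; exists x => //.
    have [_ Ufx] := fP _ xG.
    by have [n [/= <- <-]] := filter_ex (filterI Ux Ufx).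
- have [_ Ur] := fP _ (rroot_vert G).
  have [n /= <-] := filter_ex Ur.
  by have [_ ->] := FP n.
- move=> x y xG yG; have [n [r [rn xr yr <- <-]]] := common _ _ xG yG.
  by have [_ _] := Fr _ _ rn; exact.
Qed.

End rooted_isomorphism.

Section invariance.

Lemma card_fset_set_bij (T T' : choiceType) (A : set T) (B : set T') (f : T -> T') :
  finite_set A -> set_bij A B f -> #|` fset_set B| = #|` fset_set A|.
Proof.
move=> Af [fA finj fsurj].
have <- : f @` A = B by apply/seteqP; split => // _ [x Ax <-]; exact: fA.
rewrite fset_set_image// card_in_imfset//= => x y.
by rewrite !in_fset_set// => ? ? ?; exact: finj.
Qed.

Lemma rdeg_riso G G' : riso G G' -> rdeg G = rdeg G'.
Proof.
move=> [f [[fA finj fsurj] fr farc]]; have rG := rroot_vert G.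
rewrite /rdeg /rdeg_in /rdeg_out; congr addn; apply/esym.
- apply: (@card_fset_set_bij _ _ _ _ f).
    by apply: sub_finite_set (rlocfin G (rroot G)) => x; right.
  split.
  + move=> x xr; have [xG _] := rarc_vert xr.
    by rewrite /= -fr; apply/farc.
  + move=> x y; rewrite !inE => /= /rarc_vert[xG _] /rarc_vert[yG _] e.
    by apply: finj; rewrite ?inE.
  + move=> y /= yr; have [/fsurj[x xG xy] _] := rarc_vert yr.
    by exists x => //=; apply/farc => //; rewrite xy fr.
- apply: (@card_fset_set_bij _ _ _ _ f).
    by apply: sub_finite_set (rlocfin G (rroot G)) => x; left.
  split.
  + move=> x xr; have [_ xG] := rarc_vert xr.
    by rewrite /= -fr; apply/farc.
  + move=> x y; rewrite !inE => /= /rarc_vert[_ xG] /rarc_vert[_ yG] e.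
    by apply: finj; rewrite ?inE.
  + move=> y /= yr; have [_ /fsurj[x xG xy]] := rarc_vert yr.
    by exists x => //=; apply/farc => //; rewrite xy fr.
Qed.

Lemma remb_set_finite (F : digraph) (r : F) G :
  connected_digraph F -> finite_set (remb_set r G).
Proof.
move=> Fc.
have key (phi : {ffun F -> nat}) : remb_set r G phi ->
    forall x, ball_vert G #|F| (phi x).
  move=> [_ _ phiarc phir] x.
  have /connectP[p0 pp0 ->] := Fc r x.
  case/shortenP: pp0 => p pp pu _.
  exists (size p); first by apply: ltnW; rewrite -[(size p).+1]/(size (r :: p)) -(card_uniqP pu) max_card.
  rewrite -phir; elim: p r pp {pu phir} => //= y p IHp z /andP[/orP zy yp].
  exists (phi y); last exact: IHp.
  by case: zy => /phiarc; [left|right].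
set B := fset_set (ball_vert G #|F|).
apply: (@sub_finite_set _ _ [set phi | exists2 g : {ffun F -> B}, True &
    [ffun x => val (g x)] = phi]).
  move=> phi phiP.
  have phiB x : phi x \in B.
    by rewrite in_fset_set ?inE; [exact: key|exact: ball_vert_finite].
  exists [ffun x => [` phiB x]%fset] => //.
  by apply/ffunP => x; rewrite !ffunE.
rewrite (_ : [set phi | _] = (fun g : {ffun F -> B} => [ffun x => val (g x)]) @` setT).
  by apply: finite_image; exact: finite_finset.
by apply/seteqP; split => phi [g _ <-]; exists g.
Qed.

Lemma remb_riso (F : digraph) (r : F) G G' : connected_digraph F ->
  riso G G' -> remb r G = remb r G'.
Proof.
move=> Fc [f [[fA finj fsurj] fr farc]]; apply/esym.
apply: (@card_fset_set_bij _ _ _ _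
  (fun phi : {ffun F -> nat} => [ffun x => f (phi x)] : {ffun F -> nat})).
  exact: remb_set_finite.
split.
- move=> phi [pinj pG parc pr]; split.
  + move=> x y; rewrite !ffunE => e; apply: pinj.
    by apply: finj; rewrite ?inE//; exact: pG.
  + by move=> x; rewrite ffunE; apply: fA; exact: pG.
  + by move=> x y xy; rewrite !ffunE; apply/farc; [exact: pG..|exact: parc].
  + by rewrite ffunE pr.
- move=> phi psi; rewrite !inE => -[_ pG _ _] [_ qG _ _] /ffunP e.
  apply/ffunP => x; apply: finj; rewrite ?inE; [exact: pG|exact: qG|].
  by have := e x; rewrite !ffunE.
- move=> psi [pinj pG parc pr].
  have [g gP] : {g : F -> nat & forall x, rvert G (g x) /\ f (g x) = psi x}.
    apply: (@choice _ _ (fun x y => rvert G y /\ f y = psi x)) => x.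
    by have [y Gy fy] := fsurj _ (pG x); exists y.
  exists [ffun x => g x]; last by apply/ffunP => x; rewrite !ffunE (gP x).2.
  split.
  + move=> x y; rewrite !ffunE => e; apply: pinj.
    by rewrite -(gP x).2 -(gP y).2 e.
  + by move=> x; rewrite ffunE; exact: (gP x).1.
  + move=> x y xy; rewrite !ffunE; apply/farc; [exact: (gP x).1|exact: (gP y).1|].
    by rewrite (gP x).2 (gP y).2; exact: parc.
  + rewrite ffunE; apply: finj; rewrite ?inE; [exact: (gP r).1|exact: rroot_vert|].
    by rewrite (gP r).2 pr fr.
Qed.

End invariance.

HB.instance Definition _ := gen_eqMixin rdigraph.
HB.instance Definition _ := gen_choiceMixin rdigraph.

Definition risob : rel rdigraph := fun G G' => `[< riso G G' >].

Lemma risob_refl : reflexive risob.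
Proof. by move=> G; apply/asboolP; exact: iso_on_refl. Qed.

Lemma risob_sym : symmetric risob.
Proof.
by move=> G G'; apply/idP/idP => /asboolP h; apply/asboolP;
  apply: iso_on_sym h; exact: rroot_vert.
Qed.

Lemma risob_trans : transitive risob.
Proof.
move=> G2 G1 G3 /asboolP h12 /asboolP h23; apply/asboolP.
exact: iso_on_trans h12 h23.
Qed.

Canonical risob_equiv := EquivRel risob risob_refl risob_sym risob_trans.

(* The space of rooted, connected, locally finite digraphs modulo rooted
   isomorphism.  The field [R] is that in which the local metric takes its
   values. *)
Definition gstar (R : realType) : Type := {eq_quot risob}.

HB.instance Definition _ (R : realType) := Choice.on (gstar R).
HB.instance Definition _ (R : realType) := Quotient.on (gstar R).
HB.instance Definition _ (R : realType) := EqQuotient.on (gstar R).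

Lemma gstar_pi (R : realType) (G G' : rdigraph) :
  (\pi_(gstar R)%qT G = \pi_(gstar R)%qT G') <-> riso G G'.
Proof. by split=> [/eqmodP/asboolP//|h]; apply/eqmodP/asboolP. Qed.

Lemma gstar_repr (R : realType) (G : rdigraph) :
  riso (repr (\pi_(gstar R)%qT G)) G.
Proof. by apply/(gstar_pi R); rewrite reprK. Qed.

Section local_metric.
Variable R : realType.
Implicit Types x y z : gstar R.

(* Independence of the chosen representatives: [agree_pi]. *)
Definition agree x y : set nat := [set r | ball_iso r (repr x) (repr y)].

(* 1 / (1 + sup of the radii of agreement), which is 0 if the sup is +oo. *)
Definition dloc x y : R :=
  fine (1 + ereal_sup [set (r%:R)%:E | r in agree x y])^-1%E.

Lemma agree_pi (G G' : rdigraph) r :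
  agree (\pi_(gstar R) G) (\pi_(gstar R) G') r <-> ball_iso r G G'.
Proof.
have p H : ball_iso r (repr (\pi_(gstar R) H)) H.
  by apply: riso_ball_iso; exact: gstar_repr.
have q H : ball_iso r H (repr (\pi_(gstar R) H)).
  by apply: iso_on_sym (p H); exact: ball_vert_root.
split=> h.
- exact: iso_on_trans (iso_on_trans (q G) h) (p G').
- exact: iso_on_trans (iso_on_trans (p G) h) (q G').
Qed.

Lemma agree_le x y r s : (r <= s)%N -> agree x y s -> agree x y r.
Proof. exact: ball_iso_le. Qed.

Let rad x y : \bar R := ereal_sup [set (r%:R)%:E | r in agree x y].

Let rad_ge0 x y : (0 <= rad x y)%E.
Proof. by apply: ereal_sup_ubound; exists 0%N => //; exact: ball_iso0. Qed.

Let dloc_le x y x' y' : agree x' y' `<=` agree x y -> dloc x y <= dloc x' y'.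
Proof.
move=> sub; have : (rad x' y' <= rad x y)%E.
  by apply: ereal_sup_le => _ [r /sub h <-]; exists r.
rewrite /dloc -/(rad x y) -/(rad x' y').
have := rad_ge0 x y; have := rad_ge0 x' y'.
case: (rad x y) => [a| |]; case: (rad x' y') => [b| |] //=.
- rewrite !lee_fin => b0 a0 ba.
  by rewrite !inver !gt_eqF/= ?ltr_pwDl// lef_pV2 ?posrE ?ltr_pwDl// lerD2l.
- by rewrite !lee_fin => b0 _ _; rewrite inver gt_eqF/= ?ltr_pwDl// invr_ge0 addr_ge0.
Qed.

Lemma dlocxx x : dloc x x = 0.
Proof.
rewrite /dloc -/(rad x x) (_ : rad x x = +oo%E)//.
apply/eqyP => e e0; apply: (@le_trans _ _ ((Num.truncn e).+1%:R%:E)).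
  by rewrite lee_fin ltW// truncnS_gt.
by apply: ereal_sup_ubound; eexists; first exact: iso_on_refl.
Qed.

Lemma dloc_eq0 x y : dloc x y = 0 -> x = y.
Proof.
move=> d0; have radoo : rad x y = +oo%E.
  move: d0 (rad_ge0 x y); rewrite /dloc -/(rad x y); case: (rad x y) => [a| |]//=.
  rewrite lee_fin => /[swap] a0; rewrite inver gt_eqF/= ?ltr_pwDl// => /eqP.
  by rewrite invr_eq0 gt_eqF ?ltr_pwDl.
suff : riso (repr x) (repr y) by move/(gstar_pi R); rewrite !reprK.
apply: ball_iso_riso => r.
have /ereal_sup_gt[_ [s xys <-]] : (r%:R%:E < rad x y)%E by rewrite radoo ltry.
rewrite lte_fin ltr_nat => /ltnW rs.
exact: agree_le rs xys.
Qed.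

Lemma dloc_sym x y : dloc x y = dloc y x.
Proof.
have sub u v : agree u v `<=` agree v u.
  by move=> r; apply: iso_on_sym; exact: ball_vert_root.
by apply/eqP; rewrite eq_le !dloc_le.
Qed.

Lemma dloc_triangle y x z : dloc x z <= dloc x y + dloc y z.
Proof.
have d0 u v : 0 <= dloc u v.
  by rewrite -(dlocxx u); apply: dloc_le => r _; exact: iso_on_refl.
have trans r : agree x y r -> agree y z r -> agree x z r.
  exact: iso_on_trans.
have [sub|/existsNP[r /not_implyP[xyr nyzr]]] :=
    pselect (forall r, agree x y r -> agree y z r).
  by rewrite (@le_trans _ _ (dloc x y)) ?lerDl//; apply: dloc_le => r h; apply: trans (sub _ h).
rewrite (@le_trans _ _ (dloc y z)) ?lerDr//; apply: dloc_le => s yzs.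
apply: trans (yzs); apply: agree_le xyr.
by rewrite leqNgt; apply/negP => /ltnW rs; apply: nyzr; exact: agree_le yzs.
Qed.

HB.instance Definition _ := isMetric.Build R (gstar R)
  dlocxx dloc_eq0 dloc_sym dloc_triangle.

End local_metric.

Section one_vertex_rdigraph.

Let arc0 : nat -> nat -> Prop := fun _ _ => False.

Let arc0_vert x y : arc0 x y -> [set 0%N] x /\ [set 0%N] y.
Proof. by []. Qed.

Let arc0_connected x : [set 0%N] x -> exists k, walk arc0 k 0%N x.
Proof. by move=> ->; exists 0%N. Qed.

Let arc0_locfin x : finite_set [set y | arc0 x y \/ arc0 y x].
Proof. by rewrite (_ : [set _ | _] = set0)//; apply/seteqP; split => y // -[]. Qed.

Definition one_rdigraph : rdigraph :=
  @RDigraph [set 0%N] arc0 0%N (fun _ => id) arc0_vert erefl arc0_connected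
    arc0_locfin.

End one_vertex_rdigraph.

Definition gstar_point (R : realType) : gstar R := \pi_(gstar R) one_rdigraph.

HB.instance Definition _ (R : realType) :=
  isPointed.Build (gstar R) (gstar_point R).

Definition gstar_borel (R : realType) := g_sigma_algebraType (@open (gstar R)).

Section component.
Variables (G : digraph) (v : G).

Let cvert : set nat :=
  [set i | exists2 x : G, connect (@uadj G) v x & choice.pickle x = i].

Let carc (i j : nat) : Prop := exists x y : G,
  [/\ connect (@uadj G) v x, arc x y, i = choice.pickle x & j = choice.pickle y].

Let carc_irr i : ~ carc i i.
Proof.
move=> [x [y [_ xy -> /(pcan_inj choice.pickleK) e]]].
by move: xy; rewrite e arc_irr.
Qed.

Let uadj_connect x y : connect (@uadj G) v x -> uadj x y -> connect (@uadj G) v y.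
Proof. by move=> vx xy; exact: connect_trans vx (connect1 xy). Qed.

Let carc_vert i j : carc i j -> cvert i /\ cvert j.
Proof.
move=> [x [y [vx xy -> ->]]]; split; [by exists x|exists y => //=].
by apply: uadj_connect vx _; rewrite /uadj /= xy.
Qed.

Let croot : cvert (choice.pickle v).
Proof. by exists v => //=; exact: connect0. Qed.

Let cconnected i : cvert i -> exists k, walk carc k (choice.pickle v) i.
Proof.
move=> [x /= vx <-]; have /connectP[p] := vx.
elim/last_ind: p x {vx} => [|p y IHp] x /=; first by move=> _ ->; exists 0%N.
rewrite rcons_path last_rcons => /andP[vp py] ->.
have [k w] := IHp _ vp erefl; exists k.+1; apply/walkSr; eexists; first exact: w.
have vz : connect (@uadj G) v (last v p) by apply/connectP; exists p.
case/orP: (py) => a; [left|right].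
- by exists (last v p), y.
- by exists y, (last v p); split => //; exact: uadj_connect py.
Qed.

Let clocfin i : finite_set [set j | carc i j \/ carc j i].
Proof.
apply: (@sub_finite_set _ _ (range (@choice.pickle G))).
  by move=> j [] [x [y [_ _ ix jy]]]; [exists y|exists x]; rewrite ?ix ?jy.
by apply: finite_image; exact: finite_finset.
Qed.

Definition component : rdigraph :=
  RDigraph carc_irr carc_vert croot cconnected clocfin.

End component.

Definition gstar_of (R : realType) (G : digraph) (v : G) : gstar R :=
  \pi_(gstar R) (component v).

(* Independence of the chosen representative: [gdeg_pi], [gemb_pi]. *)
Definition gdeg (R : realType) (x : gstar R) : nat := rdeg (repr x).

Definition gemb (R : realType) (F : digraph) (r : F) (x : gstar R) : nat :=
  remb r (repr x).

Lemma gdeg_pi (R : realType) (G : rdigraph) : gdeg (\pi_(gstar R) G) = rdeg G.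
Proof. by apply: rdeg_riso; exact: gstar_repr. Qed.

Lemma gemb_pi (R : realType) (F : digraph) (r : F) (G : rdigraph) :
  connected_digraph F -> gemb r (\pi_(gstar R) G) = remb r G.
Proof. by move=> Fc; apply: remb_riso => //; exact: gstar_repr. Qed.

Definition uniform_on d (T : measurableType d) (R : realType)
    (P : probability T R) (V : finType) (X : T -> V) : Prop :=
  forall x : V, measurable (X @^-1` [set x]) /\
    P (X @^-1` [set x]) = (#|V|%:R^-1)%:E.

(* Convergence in distribution of the random elements [X n] of [E], each
   defined on its own probability space, to the random element [Y]. *)
Definition cvg_in_distribution (R : realType) (E : topologicalType)
    (d : nat -> measure_display) (T : forall n, measurableType (d n))
    (P : forall n, probability (T n) R) (X : forall n, T n -> E)
    (d' : measure_display) (T' : measurableType d') (P' : probability T' R)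
    (Y : T' -> E) : Prop :=
  forall f : E -> R, continuous f -> (exists M, forall x, `|f x| <= M) ->
    'E_(P n)[f \o X n]%E @[n --> \oo] --> 'E_P'[f \o Y]%E.

Definition uniformly_integrable (R : realType)
    (d : nat -> measure_display) (T : forall n, measurableType (d n))
    (P : forall n, probability (T n) R) (X : forall n, T n -> R) : Prop :=
  ereal_sup (range (fun n =>
    (\int[P n]_(w in [set w | (K < `|X n w|)%R]) (`|X n w|%R)%:E)%E))
  @[K --> +oo] --> 0%E.

(* Main.v *)
Require Import Defs.
From HB Require Import structures.
From mathcomp Require Import all_boot all_order all_algebra generic_quotient finmap.
From mathcomp Require Import all_classical all_reals all_analysis.
From mathcomp Require Import measurable_realfun lra.
Import Order.TTheory GRing.Theory Num.Theory.
Import numFieldNormedType.Exports.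

(** Write [m] for [h.-1].  For any choice of the root [r], the normalized count
    [emb H G / #|G|] is the mean over the vertices [v] of [G] of the number of
    embeddings of [H] that send [r] to [v] ([emb_sum]).  All three statements thus
    concern means, over the finite digraphs, of unbounded functionals of the rooted
    component: the power [deg ^ m] of the degree, and rooted embedding counts.

    Each such functional is exhausted from below by bounded functionals that depend
    only on a ball around the root ([exhausts]): the degree power is set to zero
    where the degree exceeds [K], and embeddings are dropped when their image
    contains a vertex of degree above [K].  Such truncations are continuous for the
    local metric, so their means converge by convergence in distribution, and their
    limit means increase to the mean in the limit by monotone convergence.
    Therefore the means of the functional itself converge to its mean in the limit
    as soon as the part lost in the truncation is small uniformly in [n]
    ([tails_gmean_cvg]), and conversely when the mean in the limit is finite
    ([gmean_cvg_tails]).  For the degree power, uniformly small tails are uniform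
    integrability ([uniformly_integrable_deg]); this gives the equivalence of
    convergence of moments and uniform integrability.

    It remains to compare tails.  An embedding of a connected [H] with [m.+1]
    vertices whose image meets a degree above [K] can be charged to a vertex [u] of
    largest degree in its image.  Exploring [H] along a spanning tree from the
    preimage of [u] leaves at most [deg u] choices at each of the [m] other
    vertices.  Hence the total loss is at most [m.+1] times the sum of [deg u ^ m]
    over the vertices [u] with [deg u > K] ([sum_homs_le]), and small degree tails
    give small embedding tails ([emb_tails]).  Conversely, if [deg v] is large then
    [deg v ^ m] is at most [4 ^ m] times the number of embeddings, centred at [v],
    of stars with [m] leaves of all orientations ([deg_pow_le]).  Where
    [deg v > K], all of these embeddings belong to the tails of the star counts,
    so small star tails give small degree tails ([deg_tails]).  The converse
    direction of the exhaustion principle applies to stars because their counts have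
    a finite mean in the limit, being at most the degree power
    ([limit_mean_star_fin]). *)

Set Implicit Arguments.
Unset Strict Implicit.
Unset Printing Implicit Defensive.

Local Open Scope classical_set_scope.
Local Open Scope ring_scope.

(* The name [arc] also belongs to an operation on cyclic sequences. *)
Local Notation arc := Defs.arc.
Local Notation dwalk H := (walk (fun a b : H => arc a b)).

(** * Homomorphisms out of a connected digraph *)

Lemma connected_walk (H : digraph) (x y : H) :
  connected_digraph H -> exists k, dwalk H k x y.
Proof.
move=> Hc; have /connectP[p] := Hc x y.
elim: p x => [|z p IHp] x /=; first by move=> _ ->; exists 0%N.
move=> /andP[/orP xz zp] /(IHp _ zp)[k w].
by exists k.+1; exists z.
Qed.

Section distance.
Variables (H : digraph) (Hc : connected_digraph H) (x : H).

Let walkb y : exists k, `[< dwalk H k x y >].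
Proof. by have [k w] := connected_walk x y Hc; exists k; apply/asboolP. Qed.

Definition udist (y : H) : nat := ex_minn (walkb y).

Lemma udist_walk y : dwalk H (udist y) x y.
Proof. by rewrite /udist; case: ex_minnP => k /asboolP. Qed.

Lemma udist_min y k : dwalk H k x y -> (udist y <= k)%N.
Proof. by rewrite /udist; case: ex_minnP => l _ h w; apply: h; apply/asboolP. Qed.

Lemma udist_parent y : y != x ->
  exists2 z, uadj z y & (udist z < udist y)%N.
Proof.
have := udist_walk y; case E: (udist y) => [|k]; first by move=> /= ->; rewrite eqxx.
move=> /walkSr[z w zy] _; exists z; first exact/orP.
by rewrite ltnS; exact: udist_min.
Qed.

End distance.

(** Each vertex other than the root has a neighbour closer to the root, its
    parent.  Choosing images outwards from the root, the image of a vertex is one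
    of at most [d.+1] neighbours of the image of its parent, and there are
    [#|H|.-1] choices to make.  Recording these choices codes the homomorphism
    injectively.  The target is an arbitrary type with neighbour lists, so that
    the bound serves for finite and for infinite digraphs. *)
Lemma size_homs_le (H : digraph) (V : eqType) (x : H) (u : V)
    (nbr : V -> seq V) (d : nat) (s : seq {ffun H -> V}) :
  connected_digraph H -> uniq s ->
  (forall phi, phi \in s -> [/\ phi x = u,
    forall a b, uadj a b -> phi b \in nbr (phi a) &
    forall a, (size (nbr (phi a)) <= d.+1)%N]) ->
  (size s <= d.+1 ^ #|H|.-1)%N.
Proof.
move=> Hc us sP.
have [p pP] : {p : H -> H & forall y, y != x ->
    uadj (p y) y && (udist Hc x (p y) < udist Hc x y)%N}.
  apply: (@choice _ _ (fun y z => y != x ->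
    uadj z y && (udist Hc x z < udist Hc x y)%N)) => y.
  have [->|yx] := eqVneq y x; first by exists x.
  by have [z zy lt] := udist_parent Hc yx; exists z => _; rewrite zy.
pose code (phi : {ffun H -> V}) : {ffun {y | y != x} -> 'I_d.+1} :=
  [ffun y => inord (index (phi (val y)) (nbr (phi (p (val y)))))].
have code_inj : {in s &, injective code}.
  move=> phi psi ps qs e.
  have [[p0 pn pd] [q0 qn qd]] := (sP _ ps, sP _ qs).
  suff main k y : (udist Hc x y < k)%N -> phi y = psi y.
    by apply/ffunP => y; exact: main (ltnSn _).
  elim: k y => // k IHk y yk; have [->|yx] := eqVneq y x; first by rewrite p0 q0.
  have /andP[py lt] := pP _ yx.
  have pq : phi (p y) = psi (p y) by apply: IHk; exact: leq_trans lt _.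
  have := congr1 (fun f : {ffun _ -> _} => val (f (exist _ y yx))) e.
  have lphi := pn _ _ py; have lpsi := qn _ _ py.
  rewrite !ffunE /= !inordK -?pq.
  - by move=> ei; rewrite -(nth_index u lphi) ei nth_index// pq.
  - by apply: leq_trans (pd (p y)); rewrite index_mem pq.
  - by apply: leq_trans (pd (p y)); rewrite index_mem.
rewrite -(size_map code) -(card_uniqP _) ?map_inj_in_uniq//.
apply: leq_trans (max_card _) _.
rewrite card_ffun card_ord card_sig; apply: eq_leq; congr expn.
by rewrite -(cardC1 x); apply: eq_card => y; rewrite !inE.
Qed.

(** Each factor [n - k] with [k < m] is at least [n / 2]. *)
Lemma pow_le_ffact n m : (m.*2 <= n)%N -> (n ^ m <= 2 ^ m * n ^_ m)%N.
Proof.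
move=> mn; have : (forall k, (k <= m)%N -> n ^ k <= 2 ^ k * n ^_ k)%N.
  elim=> // k IHk km.
  rewrite ffactnSr !expnSr (mulnACA).
  apply: leq_mul; first exact: IHk (ltnW km).
  rewrite mulnBr [(2 * n)%N]mul2n -addnn -addnBA ?leq_addr//.
  by rewrite mul2n (leq_trans _ mn)// leq_double ltnW.
exact.
Qed.

(** * Embeddings truncated by degree, and their locality *)

Definition rdeg_at (G : rdigraph) (x : nat) : nat :=
  (#|` fset_set [set u | rarc G u x]| + #|` fset_set [set u | rarc G x u]|)%N.

Definition temb_set (F : digraph) (r : F) (K : nat) (G : rdigraph) :
    set {ffun F -> nat} :=
  remb_set r G `&` [set phi | forall x, (rdeg_at G (phi x) <= K)%N].

(** Capping the degree at every vertex of the image makes the number of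
    embeddings bounded, while it still depends on a finite ball only. *)
Definition temb (F : digraph) (r : F) (K : nat) (G : rdigraph) : nat :=
  #|` fset_set (temb_set r K G)|.

Definition rnbr (G : rdigraph) (x : nat) : seq nat :=
  fset_set [set u | rarc G u x] ++ fset_set [set u | rarc G x u].

Lemma finite_in G x : finite_set [set u | rarc G u x].
Proof. by apply: sub_finite_set (rlocfin G x) => u; right. Qed.

Lemma finite_out G x : finite_set [set u | rarc G x u].
Proof. by apply: sub_finite_set (rlocfin G x) => u; left. Qed.

Lemma ball_vertS G s x y :
  ball_vert G s x -> rarc G x y \/ rarc G y x -> ball_vert G s.+1 y.
Proof. by move=> [k ks w] xy; exists k.+1 => //; apply/walkSr; exists x. Qed.

(** Degrees are seen one step further out: all neighbours of a vertex of the ball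
    of radius [s] lie in the ball of radius [s.+1], on which [g] is defined. *)
Lemma rdeg_at_iso G G' s g x :
  is_iso_on G G' (ball_vert G s.+1) (ball_vert G' s.+1) g -> ball_vert G s x ->
  rdeg_at G' (g x) = rdeg_at G x.
Proof.
move=> gP xs; have xs1 := ball_vertW (leqnSn s) xs.
have [[gs _ _] _ _] := is_iso_on_ball (ball_vertW (leqnSn s))
  (ball_vertW (leqnSn s)) gP.
have gxs := gs _ xs.
move: gP => [[gA ginj gsurj] gr garc].
have inj B : B `<=` ball_vert G s.+1 -> {in B &, injective g}.
  by move=> sB u u'; rewrite !inE => /sB su /sB su'; apply: ginj; rewrite inE.
rewrite /rdeg_at; congr addn.
- apply: (@card_fset_set_bij _ _ _ _ g); first exact: finite_in.
  split=> [u ux|u u'|u ux] /=.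
  + by apply/garc => //; apply: (ball_vertS xs); right.
  + by apply: inj => z zx; apply: (ball_vertS xs); right.
  + have /gsurj[z zs zu] : ball_vert G' s.+1 u by apply: (ball_vertS gxs); right.
    by exists z => //=; apply/garc => //; rewrite zu.
- apply: (@card_fset_set_bij _ _ _ _ g); first exact: finite_out.
  split=> [u ux|u u'|u ux] /=.
  + by apply/garc => //; apply: (ball_vertS xs); left.
  + by apply: inj => z zx; apply: (ball_vertS xs); left.
  + have /gsurj[z zs zu] : ball_vert G' s.+1 u by apply: (ball_vertS gxs); left.
    by exists z => //=; apply/garc => //; rewrite zu.
Qed.

Lemma rdeg_ball_iso G G' : ball_iso 1 G G' -> rdeg G = rdeg G'.
Proof.
move=> [g gP]; have [_ gr _] := gP.
by rewrite -[rdeg G](rdeg_at_iso gP (ball_vert_root G 0)) gr.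
Qed.

Section truncated_embeddings.
Variables (F : digraph) (Fc : connected_digraph F) (r : F).

(** The radius depends on [F] only, as embeddings do not increase the distance to
    the root. *)
Lemma remb_set_ball : exists s, forall G phi, remb_set r G phi ->
  forall x, ball_vert G s (phi x).
Proof.
exists (\max_x udist Fc r x) => G phi [_ _ parc pr] x.
exists (udist Fc r x); first exact: leq_bigmax.
rewrite -pr; have := udist_walk Fc r x; move: (udist Fc r x) => k {pr}.
elim: k (r) => [|k IHk] a /=.
  by move=> ->.
move=> [z az w]; exists (phi z); last exact: IHk.
by case: az => /parc; [left|right].
Qed.

Lemma temb_set_finite K G : finite_set (temb_set r K G).
Proof. by apply: sub_finite_set (remb_set_finite r G Fc) => phi []. Qed.

(** Composition with an isomorphism of balls carries embeddings to embeddings and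
    preserves the degrees in their images.  The inequality obtained in this way is
    symmetric in the two digraphs. *)
Lemma temb_ball_iso : exists s, forall K G G',
  ball_iso s G G' -> temb r K G = temb r K G'.
Proof.
have [s sP] := remb_set_ball; exists s.+1.
suff le K G G' : ball_iso s.+1 G G' -> (temb r K G <= temb r K G')%N.
  move=> K G G' i; apply/eqP; rewrite eqn_leq !le//.
  by apply: iso_on_sym i; exact: ball_vert_root.
move=> [g gP]; have gP' := gP; move: gP' => [[gA ginj gsurj] gr garc].
pose push (phi : {ffun F -> nat}) : {ffun F -> nat} := [ffun x => g (phi x)].
have sS phi : temb_set r K G phi -> forall x, ball_vert G s.+1 (phi x).
  by move=> [/sP h _] x; apply: ball_vertW (h x).
have push_inj : {in temb_set r K G &, injective push}.
  move=> phi psi /set_mem /sS ps /set_mem /sS qs /ffunP e; apply/ffunP => x.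
  by apply: ginj; rewrite ?inE//; have := e x; rewrite !ffunE.
rewrite /temb -(@card_fset_set_bij _ _ _ (push @` temb_set r K G) push
  (temb_set_finite K G)).
  apply: fsubset_leq_card; rewrite -fset_set_sub; last 2 first.
  - exact: finite_image (temb_set_finite K G).
  - exact: temb_set_finite.
  move=> _ [phi phiP <-]; have inS := sS _ phiP.
  move: phiP => [phiR phiK]; have [pinj pG parc pr] := phiR.
  split; first split.
  - by move=> a b; rewrite !ffunE => /ginj e; apply: pinj; apply: e; rewrite inE.
  - by move=> a; rewrite ffunE; apply: (@ball_vert_sub _ s.+1); exact: gA.
  - by move=> a b ab; rewrite !ffunE; apply/garc => //; exact: parc.
  - by rewrite ffunE pr.
  - by move=> a; rewrite ffunE (rdeg_at_iso gP)//; exact: sP.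
by split.
Qed.

Lemma temb_le_pow K G : (temb r K G <= K.+1 ^ #|F|.-1)%N.
Proof.
apply: (@size_homs_le F _ r (rroot G) (rnbr G)) => // [|phi];
  first exact: fset_uniq.
rewrite in_fset_set ?inE; last exact: temb_set_finite.
move=> [[_ _ parc pr] pK]; split => // [a b /orP ab|a].
- rewrite /rnbr mem_cat !in_fset_set; [|exact: finite_out|exact: finite_in].
  by apply/orP; case: ab => /parc ab; [right|left]; rewrite inE.
- by rewrite /rnbr size_cat; apply: leq_trans (pK a) _.
Qed.

Lemma temb_mono K L G : (K <= L)%N -> (temb r K G <= temb r L G)%N.
Proof.
move=> KL; apply: fsubset_leq_card.
rewrite -fset_set_sub; [|exact: temb_set_finite..].
by move=> phi [? pK]; split => // x; exact: leq_trans (pK x) KL.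
Qed.

(** The embeddings rooted at a given vertex are finitely many, so the degrees that
    they meet are bounded. *)
Lemma temb_remb G : exists K0, forall K, (K0 <= K)%N -> temb r K G = remb r G.
Proof.
have Rf := remb_set_finite r G Fc.
exists (\max_(phi : fset_set (remb_set r G)) \max_x
  rdeg_at G ((val phi : {ffun _ -> _}) x)).
move=> K K0; rewrite /temb /remb; congr (#|` fset_set _|).
apply/seteqP; split => [phi []//|phi phiR]; split => // x.
apply: leq_trans K0.
have phiF : phi \in fset_set (remb_set r G) by rewrite in_fset_set ?inE.
rewrite (leq_trans _ (leq_bigmax [` phiF]%fset))//=.
exact: (leq_bigmax (F := fun x => rdeg_at G (phi x))).
Qed.

End truncated_embeddings.

(** * Local functionals on the space of rooted digraphs *)

Section local_functionals.
Variable R : realType.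

(** These are the functionals to which convergence in distribution will be
    applied: being locally constant, they are continuous for the local metric. *)
Definition local_functional (S : Type) (f : gstar R -> S) : Prop :=
  exists s, forall x y, agree x y s -> f x = f y.

(** Balls that are not isomorphic at radius [s] are not isomorphic at any larger
    radius, which keeps the supremum in the metric at most [s]. *)
Lemma dloc_agree (x y : gstar R) s : dloc x y < (1 + s%:R)^-1 -> agree x y s.
Proof.
apply: contraPP => nxy; apply/negP; rewrite -leNgt /dloc.
set rad := ereal_sup _.
have rad0 : (0 <= rad)%E by apply: ereal_sup_ubound; exists 0%N => //; exact: ball_iso0.
have rads : (rad <= s%:R%:E)%E.
  apply: ge_ereal_sup => _ [k xyk <-]; rewrite lee_fin ler_nat leqNgt.
  by apply/negP => /ltnW sk; apply: nxy; exact: agree_le xyk.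
move: rad0 rads; case: rad => [a| |]//=; rewrite !lee_fin => a0 as_.
by rewrite inver gt_eqF/= ?ltr_pwDl// lef_pV2 ?posrE ?ltr_pwDl// lerD2l.
Qed.

Lemma local_preimage_open (S : Type) (f : gstar R -> S) (A : set S) :
  local_functional f -> open (f @^-1` A).
Proof.
move=> [s fs]; rewrite openE => x /= fx; rewrite /interior.
apply/(@nbhs_ballP R); exists (1 + s%:R)^-1 => /=; first by rewrite invr_gt0 ltr_pwDl.
by move=> y; rewrite ballEmdist /= => /dloc_agree /fs <-.
Qed.

Lemma local_continuous (f : gstar R -> R) : local_functional f -> continuous f.
Proof. by move=> fl; apply/continuousP => A _; exact: local_preimage_open. Qed.

Lemma local_measurable (f : gstar R -> R) (D : set (gstar_borel R)) :
  local_functional f -> measurable_fun D (f : gstar_borel R -> R).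
Proof.
move=> fl mD A _; apply: measurableI => //.
by apply: sub_sigma_algebra; exact: local_preimage_open.
Qed.

Lemma local_comp (S S' : Type) (f : gstar R -> S) (g : S -> S') :
  local_functional f -> local_functional (g \o f).
Proof. by move=> [s fs]; exists s => x y /fs /= ->. Qed.

Lemma gdeg_local : local_functional (@gdeg R).
Proof. by exists 1%N => x y; exact: rdeg_ball_iso. Qed.

Definition gtemb (F : digraph) (r : F) (K : nat) (x : gstar R) : nat :=
  temb r K (repr x).

Lemma gtemb_local (F : digraph) (r : F) K :
  connected_digraph F -> local_functional (gtemb r K).
Proof. by move=> Fc; have [s sP] := temb_ball_iso Fc r; exists s => x y; exact: sP. Qed.

End local_functionals.

(** * Functionals of a finite digraph at a vertex *)

Lemma card_fset_set_finset (T : finType) (V : choiceType) (A : {set T})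
    (f : T -> V) (B : set V) :
  injective f -> B = f @` [set x | x \in A] -> #|` fset_set B| = #|A|.
Proof.
move=> finj ->; rewrite fset_set_image; last exact: finite_finset.
rewrite card_imfset//= cardE; apply/perm_size/uniq_perm => [||x].
- exact: fset_uniq.
- exact: enum_uniq.
- by rewrite mem_enum in_fset_set ?mem_setE//; exact: finite_finset.
Qed.

Section finite_digraphs.
Variables H G : digraph.

Definition inj_homs : {set {ffun H -> G}} :=
  [set phi : {ffun H -> G} | injectiveb phi &&
      [forall x, forall y, arc x y ==> arc (phi x) (phi y)]]%SET.

Definition homs_at (r : H) (v : G) : {set {ffun H -> G}} :=
  [set phi in inj_homs | phi r == v]%SET.

Definition thoms_at (r : H) (K : nat) (v : G) : {set {ffun H -> G}} :=
  [set phi in homs_at r v | [forall x, deg (phi x) <= K]%N]%SET.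

Lemma inj_homsP (phi : {ffun H -> G}) :
  reflect (injective phi /\ forall x y, arc x y -> arc (phi x) (phi y))
  (phi \in inj_homs).
Proof.
rewrite inE; apply: (iffP andP) => -[/injectiveP pinj p]; split => //.
- by move=> x y xy; have /forallP/(_ x)/forallP/(_ y)/implyP := p; exact.
- by apply/forallP => x; apply/forallP => y; apply/implyP; exact: p.
Qed.

End finite_digraphs.

Lemma deg_component (G : digraph) (v x : G) : connect (@uadj G) v x ->
  rdeg_at (component v) (choice.pickle x) = deg x.
Proof.
move=> vx; have pinj : injective (@choice.pickle G) := pcan_inj choice.pickleK.
have nbr y : uadj x y -> connect (@uadj G) v y.
  by move=> xy; exact: connect_trans vx (connect1 xy).
rewrite /rdeg_at /deg /deg_in /deg_out; congr addn;
  apply: (card_fset_set_finset pinj); apply/seteqP; split => u /=.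
- move=> [a [b [va ab -> /pinj xb]]]; exists a => //=.
  by rewrite inE xb.
- move=> [a]; rewrite inE => ax <-; exists a, x; split => //.
  by apply: nbr; rewrite /uadj /= ax orbT.
- move=> [a [b [va ab /pinj xa ->]]]; exists b => //=.
  by rewrite inE xa.
- by move=> [b]; rewrite inE => xb <-; exists x, b.
Qed.

Lemma gdeg_of (R : realType) (G : digraph) (v : G) : gdeg (gstar_of R v) = deg v.
Proof.
by rewrite /gstar_of gdeg_pi; apply: deg_component; exact: connect0.
Qed.

Section embeddings_in_a_finite_digraph.
Variables (H : digraph) (Hc : connected_digraph H) (r : H).
Variables (R : realType) (G : digraph) (v : G).

Let push (phi : {ffun H -> G}) : {ffun H -> nat} :=
  [ffun x => choice.pickle (phi x)].

Let push_inj : injective push.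
Proof.
move=> phi psi /ffunP e; apply/ffunP => x.
by apply: (pcan_inj choice.pickleK); have := e x; rewrite !ffunE.
Qed.

Let hom_connect phi : phi \in homs_at r v -> forall x, connect (@uadj G) v (phi x).
Proof.
rewrite inE => /andP[/inj_homsP[_ parc] /eqP <-] x.
have /connectP[p rp ->] := Hc r x.
elim: p r rp => [|y p IHp] z //=.
move=> /andP[zy yp]; apply: connect_trans (IHp _ yp); apply: connect1.
by case/orP: zy => /parc ab; rewrite /uadj /= ab ?orbT.
Qed.

(** A homomorphism from a connected digraph stays in the component of the image
    of the root, so passing to the component loses no embedding. *)
Lemma remb_set_component :
  remb_set r (component v) = push @` [set phi | phi \in homs_at r v].
Proof.
have pinj : injective (@choice.pickle G) := pcan_inj choice.pickleK.
apply/seteqP; split => [psi [sinj sG sarc sr]|_ [phi phiv <-]] /=.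
  have [g gP] : {g : H -> G & forall x, choice.pickle (g x) = psi x}.
    apply: (@choice _ _ (fun x y => choice.pickle y = psi x)) => x.
    by have [y _ <-] := sG x; exists y.
  exists [ffun x => g x]; last by apply/ffunP => x; rewrite !ffunE gP.
  rewrite /= inE; apply/andP; split; last first.
    by rewrite ffunE; apply/eqP/pinj; rewrite gP sr.
  apply/inj_homsP; split => [x y|x y /sarc].
    by rewrite !ffunE => e; apply: sinj; rewrite -!gP e.
  by rewrite -!gP !ffunE => -[a [b [_ ab /pinj -> /pinj ->]]].
have vphi := hom_connect phiv.
move: (phiv); rewrite /= inE => /andP[/inj_homsP[phinj parc] /eqP pr]; split.
- by move=> x y; rewrite !ffunE => /pinj/phinj.
- by move=> x; rewrite ffunE; exists (phi x).
- by move=> x y xy; rewrite !ffunE; exists (phi x), (phi y); split => //; exact: parc.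
- by rewrite ffunE pr.
Qed.

Lemma gemb_of : gemb r (gstar_of R v) = #|homs_at r v|.
Proof.
rewrite /gstar_of gemb_pi//; apply: (card_fset_set_finset push_inj).
exact: remb_set_component.
Qed.

Lemma gtemb_of K : gtemb r K (gstar_of R v) = #|thoms_at r K v|.
Proof.
rewrite /gtemb; have [s sP] := temb_ball_iso Hc r.
rewrite (sP K _ (component v)); last by apply: riso_ball_iso; exact: gstar_repr.
apply: (card_fset_set_finset push_inj).
have degE phi x : phi \in homs_at r v ->
    rdeg_at (component v) (push phi x) = deg (phi x).
  by move=> phiv; rewrite ffunE; apply: deg_component; exact: hom_connect.
rewrite /temb_set remb_set_component; apply/seteqP.
split => [_ [[phi phiv <-] pK]|psi [phi]] /=.
  exists phi => //; rewrite /= inE [_ \in _]phiv; apply/forallP => x.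
  by rewrite -degE//; exact: pK.
rewrite /= inE => /andP[phiv /forallP pK] <-; split; first by exists phi.
by move=> x /=; rewrite degE.
Qed.

End embeddings_in_a_finite_digraph.

(** Whatever the choice of [r], sorting embeddings by the image of [r] expresses
    the normalized embedding count as the mean over [G] of a rooted count. *)
Lemma emb_sum (H G : digraph) (r : H) : emb H G = (\sum_(v : G) #|homs_at r v|)%N.
Proof.
rewrite /emb -/(inj_homs H G) -sum1_card.
rewrite (partition_big (fun phi : {ffun H -> G} => phi r) predT)//=.
apply: eq_bigr => v _; rewrite -sum1_card; apply: eq_bigl => phi.
by rewrite [in RHS]inE.
Qed.

(** * Degree powers against embedding counts *)

Lemma leq_expn2r (a b m : nat) : (a <= b)%N -> (a ^ m <= b ^ m)%N.
Proof. by case: m => [|m] ab; rewrite ?expn0 ?leq_exp2r. Qed.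

Section large_degrees.
Variables (H G : digraph).
Hypothesis Hc : connected_digraph H.

(** Once the image [u] of a vertex of largest degree is pinned down, the number of
    homomorphisms is bounded by a power of [deg u] alone, with the exponent that
    moments of the degree can pay for. *)
Lemma card_homs_max_deg (x : H) (u : G) : (0 < deg u)%N ->
  (#|[set phi in homs_at x u | [forall y, deg (phi y) <= deg u]%N]%SET|
    <= deg u ^ #|H|.-1)%N.
Proof.
case E : (deg u) => [//|d] _; rewrite cardE.
pose nbr (w : G) : seq G :=
  enum [set z : G | arc z w]%SET ++ enum [set z : G | arc w z]%SET.
apply: (size_homs_le (x := x) (u := u) (nbr := nbr)) => //; first exact: enum_uniq.
move=> phi; rewrite mem_enum inE => /andP[]; rewrite inE.
move=> /andP[/inj_homsP[_ parc] /eqP px] /forallP pd; split => // [a b|a].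
- rewrite /nbr mem_cat !mem_enum !inE.
  by case/orP=> /parc ->; rewrite ?orbT.
- by rewrite /nbr size_cat -!cardE; apply: leq_trans (pd a) _.
Qed.

(** An embedding lost in the truncation meets a vertex of degree above [K].
    Charge it to a vertex [x] of [H] whose image [u] has the largest degree in the
    image; then [deg u > K], and [card_homs_max_deg] bounds the number of
    embeddings charged to [(x, u)]. *)
Lemma sum_homs_le (r : H) (K : nat) :
  (\sum_(v : G) #|homs_at r v| <= \sum_(v : G) #|thoms_at r K v| +
     #|H| * \sum_(u : G | K < deg u) deg u ^ #|H|.-1)%N.
Proof.
pose big (phi : {ffun H -> G}) := [exists x, K < deg (phi x)]%N.
have -> : (\sum_(v : G) #|homs_at r v| = \sum_(v : G) #|thoms_at r K v| +
    #|[set phi in inj_homs H G | big phi]%SET|)%N.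
  rewrite (_ : #|[set phi in inj_homs H G | big phi]%SET| =
      \sum_(v : G) #|[set phi in homs_at r v | big phi]%SET|)%N; last first.
    rewrite -sum1_card (partition_big (fun phi : {ffun H -> G} => phi r) predT)//=.
    apply: eq_bigr => v _; rewrite -sum1_card; apply: eq_bigl => phi.
    by rewrite !inE -!andbA; congr andb; rewrite andbCA andbC andbA andbC.
  rewrite -big_split /=; apply: eq_bigr => v _.
  rewrite -(cardsID [set phi : {ffun H -> G} | [forall x, deg (phi x) <= K]%N]%SET
    (homs_at r v)).
  congr addn; apply: eq_card => phi; rewrite !inE//.
  rewrite andbC; congr andb; rewrite /big negb_forall.
  by apply: eq_existsb => x; rewrite -ltnNge.
rewrite leq_add2l.
(* At least one pair [(x, u)] is charged for each lost embedding. *)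
pose maxat x u (phi : {ffun H -> G}) :=
  phi \in [set phi in homs_at x u | [forall y, deg (phi y) <= deg u]%N]%SET.
have le phi : phi \in [set phi in inj_homs H G | big phi]%SET ->
    (1 <= \sum_(x : H) \sum_(u : G | K < deg u) maxat x u phi)%N.
  rewrite inE => /andP[phiI /existsP[x0 x0K]].
  have [x _ xmax] := arg_maxnP (fun x => deg (phi x)) (erefl (xpredT x0)).
  rewrite (bigD1 x)//= (bigD1 (phi x))//=; last exact: leq_trans x0K (xmax _ isT).
  rewrite (_ : maxat x (phi x) phi = true)//.
  rewrite /maxat !inE eqxx andbT; apply/andP; split; first by move: phiI; rewrite inE.
  by apply/forallP => y; exact: xmax.
rewrite -sum1_card (leq_trans (leq_sum _ le))// exchange_big /= -sum_nat_const.
apply: leq_sum => x _; rewrite exchange_big /=; apply: leq_sum => u uK.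
rewrite (leq_trans _ (card_homs_max_deg x _)) ?(leq_ltn_trans _ uK)//.
rewrite -sum1_card big_mkcond [leqRHS]big_mkcond /=; apply: leq_sum => phi _.
by rewrite /maxat; case: ifP => // _; case: (_ \in _).
Qed.

End large_degrees.

(** The total degree counts arcs in both directions, so recovering its power from
    star counts takes the stars of all orientations. *)
Section stars.
Variables (m : nat) (s : {ffun 'I_m -> bool}).

Definition star_arc (x y : option 'I_m) : bool :=
  match x, y with
  | None, Some i => s i
  | Some i, None => ~~ s i
  | _, _ => false
  end.

Lemma star_arc_irr : irreflexive star_arc.
Proof. by case. Qed.

Definition star : digraph := Digraph star_arc_irr.

Definition star_center : star := None.

Lemma card_star : #|star| = m.+1.
Proof. by rewrite card_option card_ord. Qed.

Lemma star_connected : connected_digraph star.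
Proof.
have cN (i : 'I_m) : @uadj star None (Some i) by rewrite /uadj /=; case: (s i).
have sym : connect_sym (@uadj star).
  by apply: sym_connect_sym => x y; rewrite /uadj /= orbC.
have c x : connect (@uadj star) None x.
  by case: x => [i|]; [exact: connect1 (cN i)|exact: connect0].
by move=> x y; apply: connect_trans (c y); rewrite sym.
Qed.

End stars.

Section star_embeddings.
Variables (m : nat) (G : digraph).
Implicit Types (v : G) (s : {ffun 'I_m -> bool}).

Definition neighbours v : {set G} := [set u | uadj v u]%SET.

Lemma card_neighbours_le v : (#|neighbours v| <= deg v)%N.
Proof.
rewrite (_ : neighbours v = [set u : G | arc u v]%SET :|: [set u : G | arc v u]%SET)%SET.
  by rewrite cardsU leq_subr.
by apply/setP => u; rewrite !inE orbC.
Qed.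

Lemma deg_le_neighbours v : (deg v <= (#|neighbours v|).*2)%N.
Proof.
rewrite -addnn /deg /deg_in /deg_out.
by apply: leq_add; apply: subset_leq_card; apply/fintype.subsetP => u;
  rewrite !inE /uadj /= => ->; rewrite ?orbT.
Qed.

(** An embedding that sends the centre to [v] is determined by the images of the
    leaves, which are neighbours of [v].  The cap on the degrees applies to [v]
    itself, so nothing survives when [deg v > K]. *)
Lemma card_star_thoms_le s K v :
  (#|thoms_at (star_center s) K v| <= if deg v <= K then deg v ^ m else 0)%N.
Proof.
case: ifPn => [_|vK]; last first.
  rewrite leqn0 cards_eq0 -finset.subset0; apply/fintype.subsetP => phi.
  rewrite inE => /andP[]; rewrite inE => /andP[_ /eqP pr] /forallP/(_ (star_center s)).
  by rewrite pr (negPf vK).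
apply: (@leq_trans (#|neighbours v| ^ #|'I_m|)); last first.
  by rewrite card_ord leq_expn2r// card_neighbours_le.
rewrite -card_ffun_on.
pose leaves (phi : {ffun star s -> G}) : {ffun 'I_m -> G} := [ffun i => phi (Some i)].
rewrite -(@card_in_imset _ _ leaves); last first.
  move=> phi psi; rewrite !inE => /andP[/andP[_ /eqP p0] _] /andP[/andP[_ /eqP q0] _] e.
  apply/ffunP => -[i|]; last by rewrite [LHS]p0 [RHS]q0.
  by have /ffunP/(_ i) := e; rewrite !ffunE.
apply: subset_leq_card; apply/fintype.subsetP => _ /imsetP[phi + ->].
rewrite inE => /andP[+ _]; rewrite inE => /andP[/inj_homsP[_ parc] /eqP pr].
apply/ffun_onP => i; rewrite ffunE inE.
have : @uadj (star s) None (Some i) by rewrite /uadj /=; case: (s i).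
by rewrite -pr; case/orP => /parc; rewrite /uadj /= => ->; rewrite ?orbT.
Qed.

(** Every injective [m]-tuple of neighbours of [v] is the list of leaves of a star
    centred at [v], for the orientation read off from [G].  As opposite arcs may
    double a neighbour, [v] has at least [deg v / 2] neighbours; for a large degree
    passing from tuples to injective tuples costs a further factor [2 ^ m]. *)
Lemma deg_pow_le v : (4 * m <= deg v)%N ->
  (deg v ^ m <= 4 ^ m * \sum_(s : {ffun 'I_m -> bool}) #|homs_at (star_center s) v|)%N.
Proof.
move=> mv; have vN := deg_le_neighbours v.
have mN : (m.*2 <= #|neighbours v|)%N.
  by rewrite -leq_double (leq_trans _ vN)// (leq_trans _ mv)// -!mul2n mulnA.
apply: (@leq_trans (2 ^ m * #|neighbours v| ^ m)).
  by rewrite -expnMn mul2n leq_expn2r.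
rewrite (_ : 4 = 2 * 2)%N// expnMn -mulnA leq_mul2l; apply/orP; right.
apply: leq_trans (pow_le_ffact mN) _; rewrite leq_mul2l; apply/orP; right.
rewrite -{1}(card_ord m) -card_inj_ffuns_on.
pose orient (f : {ffun 'I_m -> G}) : {ffun 'I_m -> bool} := [ffun i => arc v (f i)].
rewrite -sum1_card (partition_big orient predT)//=; apply: leq_sum => s _.
rewrite sum1dep_card.
pose ext (f : {ffun 'I_m -> G}) : {ffun star s -> G} :=
  [ffun x : option 'I_m => if x is Some i then f i else v].
rewrite -(@card_in_imset _ _ ext); last first.
  move=> f g _ _ /ffunP e; apply/ffunP => i.
  by have := e (Some i); rewrite !ffunE.
apply: subset_leq_card; apply/fintype.subsetP => _ /imsetP[f + ->]; rewrite inE.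
move=> /[!inE] /andP[/andP[/ffun_onP fN /injectiveP finj] /eqP fs].
rewrite [ext f (star_center s)]ffunE eqxx andbT.
have fv i : f i != v.
  by apply/eqP => e; have := fN i; rewrite e inE /uadj /= arc_irr.
have fsi i : s i = arc v (f i) by rewrite -fs ffunE.
suff : ext f \in inj_homs (star s) G by rewrite inE.
apply/inj_homsP; split.
- move=> [i|] [j|]; rewrite !ffunE //.
  + by move=> /finj ->.
  + by move=> /eqP; rewrite (negPf (fv i)).
  + by move=> /esym/eqP; rewrite (negPf (fv j)).
- move=> [i|] [j|]; rewrite !ffunE //=.
  + by rewrite fsi => /negPf a; have := fN i; rewrite inE /uadj /= a.
  + by rewrite fsi.
Qed.

End star_embeddings.

(** * Means, truncation and uniform integrability *)

(** The interchange of limits that underlies every implication.  Here [A n] is a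
    mean over the [n]-th digraph, [t K n] the mean of its truncation at level [K],
    [B K] the limit of the truncated means, and [a] the mean in the limit. *)
Section real_exhaustion.
Variables (R : realType) (A B : nat -> R) (t : nat -> nat -> R) (a : \bar R).
Hypothesis tB : forall K, t K n @[n --> \oo] --> B K.
Hypothesis Ba : (B K)%:E @[K --> \oo] --> a.
Hypothesis tA : forall K n, t K n <= A n.
Hypothesis t_mono : forall K L n, (K <= L)%N -> t K n <= t L n.

Let B_mono : {homo B : K L / (K <= L)%N >-> K <= L}.
Proof.
by move=> K L KL; apply: ler_cvg_to (@tB K) (@tB L) _; apply: nearW => n; exact: t_mono.
Qed.

Let B_le (K L : nat) e : (forall n, t L n <= t K n + e) -> B L <= B K + e.
Proof.
move=> h; apply: ler_cvg_to (@tB L) (cvgD (@tB K) (cvg_cst e)) _.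
exact: nearW.
Qed.

(** The uniform tail bound with [e = 1] bounds [B], so the limit [a] is finite even
    though this is not assumed; a three-term estimate then concludes. *)
Lemma cvg_of_uniform_tails :
  (forall e, 0 < e -> exists K, forall n, A n <= t K n + e) ->
  (A n)%:E @[n --> \oo] --> a.
Proof.
move=> tails; have [K1 K1P] := tails 1 ltr01.
have Bub : has_ubound (range B).
  exists (B K1 + 1) => _ [L _ <-]; apply: B_le => n.
  exact: le_trans (tA L n) (K1P n).
have Bcvg := nondecreasing_cvgn B_mono Bub.
set b := sup (range B) in Bcvg.
have -> : a = b%:E.
  apply: (cvg_unique (@ereal_hausdorff R) Ba).
  by apply: cvg_EFin Bcvg; exact: nearW.
apply: cvg_EFin; first exact: nearW.
apply/cvgrPdist_le => e e0; have e2 : 0 < e / 2 by rewrite divr_gt0.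
have [K KP] := tails _ e2.
have Kb : B K <= b by apply: ub_le_sup => //; exists K.
have bK : b <= B K + e / 2.
  apply: ge_sup; first by exists (B 0), 0%N.
  by move=> _ [L _ <-]; apply: B_le => n; exact: le_trans (tA L n) (KP n).
have /cvgrPdist_le/(_ _ e2) := @tB K.
apply: filterS => n; rewrite /= !ler_distl => /andP[h1 h2].
have := KP n; have := tA K n => h3 h4.
by apply/andP; split; lra.
Qed.

Hypothesis t_eq : forall n, exists K, t K n = A n.

(** A level [K0] with [B K0] close to [a] makes the tail small for all large [n],
    because [A n] and [t K0 n] are then close to [a] and [B K0].  The finitely many
    remaining [n] have no tail at all beyond some level. *)
Lemma uniform_tails_of_cvg : a \is a fin_num -> (A n)%:E @[n --> \oo] --> a ->
  forall e, 0 < e -> exists K, forall n, A n <= t K n + e.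
Proof.
move: Ba => + + + e e0; case: a => // b Bb _ /fine_cvgP[_ Ab].
have e3 : 0 < e / 3 by rewrite divr_gt0.
have /fine_cvgP[_ /cvgrPdist_le/(_ _ e3)[K0 _ K0P]] := Bb.
have := K0P K0 (leqnn _); rewrite /= ler_distl => /andP[b1 b2].
have /cvgrPdist_le/(_ _ e3)[N1 _ N1P] := Ab.
have /cvgrPdist_le/(_ _ e3)[N2 _ N2P] := @tB K0.
have [k kP] := choice t_eq.
exists (maxn K0 (\max_(i < maxn N1 N2) k i)) => n.
have [nN|nN] := ltnP n (maxn N1 N2).
  rewrite -[X in X <= _]kP -[X in X <= _]addr0 lerD ?(ltW e0)//; apply: t_mono.
  rewrite leq_max; apply/orP; right.
  exact: (leq_bigmax (F := fun i : 'I_ _ => k i) (Ordinal nN)).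
have h1 := N1P n (leq_trans (leq_maxl _ _) nN).
have h2 := N2P n (leq_trans (leq_maxr _ _) nN).
have h3 : t K0 n <= t (maxn K0 (\max_(i < maxn N1 N2) k i)) n.
  by apply: t_mono; exact: leq_maxl.
move: h1 h2; rewrite /= !ler_distl => /andP[? ?] /andP[? ?].
by lra.
Qed.

End real_exhaustion.

Section mean.
Variable R : realType.

Definition mean (V : finType) (F : V -> R) : R := (\sum_(x : V) F x) / #|V|%:R.

Lemma ler_mean (V : finType) (F F' : V -> R) :
  (forall x, F x <= F' x) -> mean F <= mean F'.
Proof. by move=> FF'; rewrite ler_wpM2r ?invr_ge0// ler_sum. Qed.

Lemma meanD (V : finType) (F F' : V -> R) : mean F + mean F' = mean (fun x => F x + F' x).
Proof. by rewrite /mean -mulrDl big_split. Qed.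

Context d (T : measurableType d) (P : probability T R) (V : finType) (X : T -> V).
Hypothesis XU : uniform_on P X.

(** The law of [X] is a sum of [#|V|] point masses, so a function of [X] is a finite
    combination of indicators. *)
Lemma expectation_uniform (F : V -> R) : (forall x, 0 <= F x) ->
  'E_P[F \o X]%E = (mean F)%:E.
Proof.
move=> F0; rewrite unlock.
have mI x : measurable_fun setT (EFin \o (\1_(X @^-1` [set x]) : T -> R)).
  by apply/measurable_EFinP; apply: measurable_indic; exact: (XU x).1.
transitivity (\int[P]_w (\sum_(x : V) (F x)%:E * (\1_(X @^-1` [set x]) w)%:E))%E.
  apply: eq_integral => w _; rewrite (bigD1 (X w))//= big1 ?adde0.
    by rewrite indicE mem_set// mule1.
  by move=> x xw; rewrite indicE memNset ?mule0//= => e; rewrite e eqxx in xw.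
rewrite ge0_integral_sum//; last 2 first.
- by move=> x; apply: measurable_funeM; exact: mI.
- by move=> x w _; rewrite mule_ge0// lee_fin.
transitivity (\sum_(x : V) (F x / #|V|%:R)%:E)%E; last by rewrite sumEFin -mulr_suml.
apply: eq_bigr => x _; rewrite ge0_integralZl_EFin//.
rewrite integral_indic//; last exact: (XU x).1.
have [_ Px] := XU x; rewrite setIT [X in (_ * X)%E = _]Px.
  by rewrite EFinM.
exact: mI.
Qed.

End mean.

(** The tail integral decreases in the threshold, so natural thresholds suffice. *)
Lemma uniformly_integrableP (R : realType) (V : nat -> finType)
    (d : nat -> measure_display) (T : forall n, measurableType (d n))
    (P : forall n, probability (T n) R) (X : forall n, T n -> V n)
    (F : forall n, V n -> R) :
  (forall n, uniform_on (P n) (X n)) -> (forall n x, 0 <= F n x) ->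
  uniformly_integrable P (fun n w => F n (X n w)) <->
  (forall e, 0 < e -> exists K : nat, forall n,
     mean (fun x => if K%:R < F n x then F n x else 0) <= e).
Proof.
move=> XU F0.
have tailE (K : R) n : (\int[P n]_(w in [set w | (K < `|F n (X n w)|)%R])
    (`|F n (X n w)|%R)%:E = (mean (fun x => if (K < F n x)%R then F n x else 0))%:E)%E.
  rewrite -(expectation_uniform (XU n)); last by move=> x; case: ifP.
  rewrite unlock integral_mkcond; apply: eq_integral => w _.
  rewrite /patch /=; case: ifPn => [|]; first by rewrite inE /= ger0_norm// => ->.
  by rewrite notin_setE /= ger0_norm// => /negP/negPf ->.
pose S (K : R) := ereal_sup
  (range (fun n => (mean (fun x => if (K < F n x)%R then F n x else 0))%:E)).
have SE : (fun K : R => ereal_sup (range (fun n =>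
    (\int[P n]_(w in [set w | (K < `|F n (X n w)|)%R]) (`|F n (X n w)|%R)%:E)%E))) = S.
  apply/funext => K; apply: (congr1 (fun f : nat -> \bar R => ereal_sup (range f))).
  by apply/funext => n; exact: tailE.
rewrite /uniformly_integrable SE.
split=> [S0 e e0|tails].
  have /S0 : nbhs (0%:E : \bar R) [set x | (x < e%:E)%E].
    by apply: open_ereal_lt'; rewrite lte_fin.
  move=> [M [_ MP]]; exists (Num.truncn M).+1 => n; rewrite -lee_fin.
  apply: le_trans (ltW (MP (Num.truncn M).+1%:R _)); last exact: truncnS_gt.
  by apply: ereal_sup_ubound; exists n.
have S_ge0 K : (0 <= S K)%E.
  apply: (@le_trans _ _ (mean (fun x => if K < F 0%N x then F 0%N x else 0))%:E).
    rewrite lee_fin mulr_ge0 ?invr_ge0// sumr_ge0// => x _; by case: ifP.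
  by apply: ereal_sup_ubound; exists 0%N.
move=> A [e /= e0 eA]; have e2 : 0 < e / 2 by rewrite divr_gt0.
have [K KP] := tails _ e2.
exists K%:R; split; first exact: num_real.
move=> L KL /=; have : (S L <= (e / 2)%:E)%E.
  apply: ge_ereal_sup => _ [n _ <-]; rewrite lee_fin; apply: le_trans (KP n).
  apply: ler_mean => x; case: ifP => [|_]; last by case: ifP.
  by move=> /(lt_trans KL) ->.
move: (S_ge0 L); case: (S L) => [x| |]//; rewrite !lee_fin => x0 xe.
by apply: eA; rewrite /= sub0r normrN ger0_norm// (le_lt_trans xe)//
  ltr_pdivrMr// ltr_pMr ?ltr1n.
Qed.

(** * Exhaustions and the limit of means *)

Section exhaustion.
Variable R : realType.
Implicit Types (f : gstar R -> nat) (t : nat -> gstar R -> nat).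

(** An approximation from below by functionals whose means converge along any
    sequence that converges in distribution: bounded local functionals, increasing
    to [f] and eventually equal to [f] at each point. *)
Definition exhausts t f : Prop :=
  [/\ forall K, local_functional (t K),
      forall K, exists M, forall x, (t K x <= M)%N,
      forall x K L, (K <= L)%N -> (t K x <= t L x)%N &
      forall x, exists K0, forall K, (K0 <= K)%N -> t K x = f x].

Definition gdeg_trunc (m K : nat) (x : gstar R) : nat :=
  if (gdeg x <= K)%N then (gdeg x ^ m)%N else 0%N.

Lemma gdeg_exhausts m : exhausts (gdeg_trunc m) (fun x => gdeg x ^ m)%N.
Proof.
split => [K|K|x K L KL|x].
- exact: (local_comp (fun D => if (D <= K)%N then (D ^ m)%N else 0%N) (@gdeg_local R)).
- by exists (K ^ m)%N => x; rewrite /gdeg_trunc; case: ifP => // xK; rewrite leq_expn2r.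
- by rewrite /gdeg_trunc; case: ifP => // xK; rewrite (leq_trans xK KL).
- by exists (gdeg x) => K xK; rewrite /gdeg_trunc xK.
Qed.

Lemma gtemb_exhausts (H : digraph) (r : H) :
  connected_digraph H -> exhausts (gtemb r) (gemb r).
Proof.
move=> Hc; split => [K|K|x K L KL|x].
- exact: gtemb_local.
- by exists (K.+1 ^ #|H|.-1)%N => x; exact: temb_le_pow.
- exact: temb_mono.
- exact: temb_remb.
Qed.

Context (G : nat -> digraph)
    (d : nat -> measure_display) (T : forall n, measurableType (d n))
    (P : forall n, probability (T n) R) (v : forall n, T n -> G n)
    (d' : measure_display) (T' : measurableType d') (P' : probability T' R)
    (Gs : {RV P' >-> gstar_borel R}).
Hypothesis v_unif : forall n, uniform_on (P n) (@v n).
Hypothesis Gcvg : cvg_in_distribution P (fun n w => gstar_of R (@v n w)) P'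
  (Gs : T' -> gstar R).

Definition gmean n f : R := mean (fun x : G n => (f (gstar_of R x))%:R).

Definition limit_mean f : \bar R := 'E_P'[fun w => (f (Gs w : gstar R))%:R]%E.

Definition uniform_tails t f : Prop :=
  forall e : R, 0 < e -> exists K, forall n, gmean n f <= gmean n (t K) + e.

Lemma limit_mean_ge0 f : (0 <= limit_mean f)%E.
Proof. by rewrite /limit_mean unlock; apply: integral_ge0 => w _; rewrite lee_fin. Qed.

Lemma local_measurable_limit f :
  local_functional f -> measurable_fun setT (fun w => (f (Gs w : gstar R))%:R : R).
Proof.
move=> fl; have mf := @local_measurable R _ setT (local_comp (fun k => k%:R : R) fl).
exact: (measurableT_comp mf).
Qed.

Lemma limit_mean_fin f M : local_functional f -> (forall x, (f x <= M)%N) ->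
  limit_mean f \is a fin_num.
Proof.
move=> fl fM; rewrite ge0_fin_numE ?limit_mean_ge0// (@le_lt_trans _ _ (M%:R)%:E) ?ltry//.
rewrite /limit_mean unlock.
have -> : ((M%:R)%:E = \int[P']_w (M%:R : R)%:E)%E.
  by rewrite integral_cst// [X in (_ * X)%E]probability_setT mule1.
apply: ge0_le_integral => //.
- by apply/measurable_EFinP; exact: local_measurable_limit.
- by move=> w _; rewrite lee_fin ler_nat.
Qed.

(** Convergence in distribution enters here: a bounded local functional is an
    admissible test function. *)
Lemma gmean_local_cvg f M : local_functional f -> (forall x, (f x <= M)%N) ->
  gmean n f @[n --> \oo] --> fine (limit_mean f).
Proof.
move=> fl fM; pose g (x : gstar R) : R := (f x)%:R.
have gl : local_functional g := local_comp (fun k => k%:R) fl.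
have := Gcvg (local_continuous gl).
have gb : exists M, forall x, `|g x| <= M.
  by exists M%:R => x; rewrite /g ger0_norm// ler_nat.
move=> /(_ gb).
have -> : (fun n => 'E_(P n)[g \o (fun w => gstar_of R (@v n w))]%E) =
    (fun n => (gmean n f)%:E).
  by apply/funext => n; rewrite -(expectation_uniform (@v_unif n)).
have -> : 'E_P'[g \o (Gs : T' -> gstar R)]%E = limit_mean f by [].
rewrite -(fineK (limit_mean_fin fl fM)) => h.
by have /fine_cvgP[] := h.
Qed.

Lemma limit_mean_exhausts t f : exhausts t f ->
  limit_mean (t K) @[K --> \oo] --> limit_mean f.
Proof.
move=> [tl tM tmono tf].
have mc := @cvg_monotone_convergence _ _ R P' setT measurableT
  (fun K w => ((t K (Gs w : gstar R))%:R)%:E).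
rewrite /limit_mean unlock.
rewrite (_ : (\int[P']_w _)%E =
  (\int[P']_w limn (fun K => ((t K (Gs w : gstar R))%:R)%:E))%E); last first.
  apply: eq_integral => w _; apply/esym/lim_near_cst => //.
  by have [K0 K0P] := tf (Gs w : gstar R); exists K0 => // K /K0P /= ->.
apply: mc => //.
- by move=> K; apply/measurable_EFinP; exact: local_measurable_limit.
- by move=> w _ K L KL; rewrite lee_fin ler_nat; exact: tmono.
Qed.

Section cvg_iff_tails.
Variables (t : nat -> gstar R -> nat) (f : gstar R -> nat).
Hypothesis tf : exhausts t f.

Let tB K : gmean n (t K) @[n --> \oo] --> fine (limit_mean (t K)).
Proof. by have [tl tM _ _] := tf; have [M MP] := tM K; exact: gmean_local_cvg MP. Qed.

Let Ba : (fine (limit_mean (t K)))%:E @[K --> \oo] --> limit_mean f.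
Proof.
rewrite (_ : (fun K => (fine (limit_mean (t K)))%:E) = (fun K => limit_mean (t K))).
  exact: limit_mean_exhausts.
apply/funext => K; rewrite fineK//.
by have [tl tM _ _] := tf; have [M MP] := tM K; exact: limit_mean_fin MP.
Qed.

Let t_mono K L n : (K <= L)%N -> gmean n (t K) <= gmean n (t L).
Proof.
by move=> KL; apply: ler_mean => x; rewrite ler_nat; have [_ _ h _] := tf; exact: h.
Qed.

Let tA K n : gmean n (t K) <= gmean n f.
Proof.
apply: ler_mean => x; rewrite ler_nat; have [_ _ h1 h2] := tf.
have [K0 K0P] := h2 (gstar_of R x).
by rewrite -(K0P (maxn K K0)) ?leq_maxr//; apply: h1; rewrite leq_maxl.
Qed.

Let t_eq n : exists K, gmean n (t K) = gmean n f.
Proof.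
have [_ _ _ h2] := tf; have [k kP] := choice (fun x : G n => h2 (gstar_of R x)).
exists (\max_x k x); congr (_ / _); apply: eq_bigr => x _; congr _%:R.
exact: kP (leq_bigmax x).
Qed.

Lemma tails_gmean_cvg : uniform_tails t f ->
  (gmean n f)%:E @[n --> \oo] --> limit_mean f.
Proof. exact: cvg_of_uniform_tails tB Ba tA t_mono. Qed.

Lemma gmean_cvg_tails : (limit_mean f < +oo)%E ->
  (gmean n f)%:E @[n --> \oo] --> limit_mean f -> uniform_tails t f.
Proof.
move=> foo; apply: (uniform_tails_of_cvg tB Ba t_mono t_eq).
by rewrite ge0_fin_numE// limit_mean_ge0.
Qed.

End cvg_iff_tails.

Section degree_tails.
Variable m : nat.

Definition large_deg n (K : nat) : R :=
  mean (fun x : G n => if (K < deg x)%N then ((deg x)%:R ^+ m : R) else 0).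

Lemma large_deg_tail n K :
  gmean n (fun x => gdeg x ^ m)%N = gmean n (gdeg_trunc m K) + large_deg n K.
Proof.
rewrite /gmean /large_deg meanD; congr (_ / _); apply: eq_bigr => x _.
rewrite /gdeg_trunc gdeg_of leqNgt natrX.
by case: (K < deg x)%N; rewrite /= ?natrX ?addr0 ?add0r.
Qed.

Lemma uniform_tails_deg : uniform_tails (gdeg_trunc m) (fun x => gdeg x ^ m)%N <->
  forall e : R, 0 < e -> exists K, forall n, large_deg n K <= e.
Proof.
by split=> h e /h[K KP]; exists K => n; have := KP n; rewrite (large_deg_tail n K) lerD2l.
Qed.

(** Thresholds on the degree and on its power are exchanged by means of
    [deg x <= deg x ^ m], which needs [0 < m]. *)
Lemma uniformly_integrable_deg : (0 < m)%N ->
  uniformly_integrable P (fun n w => (deg (@v n w))%:R ^+ m) <->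
  uniform_tails (gdeg_trunc m) (fun x => gdeg x ^ m)%N.
Proof.
move=> m0; apply: iff_trans (iff_sym uniform_tails_deg).
have F0 n (x : G n) : 0 <= (deg x)%:R ^+ m :> R by rewrite exprn_ge0.
apply: iff_trans (uniformly_integrableP (@v_unif) F0) _.
split=> h e /h[K KP].
- exists K => n; apply: le_trans (KP n); apply: ler_mean => x; case: ifP => [xK|_].
    rewrite -natrX ltr_nat (leq_trans xK)//.
    by have [->//|x0] := posnP (deg x); rewrite -{1}(expn1 (deg x)) leq_pexp2l.
  by case: ifP => // _; rewrite exprn_ge0.
- exists (K ^ m)%N => n; apply: le_trans (KP n); apply: ler_mean => x.
  case: ifP => [xK|_].
    by move: xK; rewrite -natrX ltr_nat ltn_exp2r// => ->.
  by case: ifP => // _; rewrite exprn_ge0.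
Qed.

Lemma emb_tails (H : digraph) (r : H) : #|H| = m.+1 -> connected_digraph H ->
  uniform_tails (gdeg_trunc m) (fun x => gdeg x ^ m)%N ->
  uniform_tails (gtemb r) (gemb r).
Proof.
move=> Hm Hc /uniform_tails_deg tails e e0.
have [|K KP] := tails (e / m.+1%:R); first by rewrite divr_gt0.
exists K => n; apply: (@le_trans _ _ (gmean n (gtemb r K) + m.+1%:R * large_deg n K)).
  rewrite /gmean /mean /large_deg mulrA -mulrDl ler_wpM2r ?invr_ge0//.
  rewrite -big_mkcond /=.
  have := sum_homs_le (G n) Hc r K; rewrite Hm /=.
  rewrite -(ler_nat R) natrD natrM !natr_sum.
  under eq_bigr do rewrite -(gemb_of Hc r R).
  under [X in _ <= X + _]eq_bigr do rewrite -(gtemb_of Hc r R).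
  by under [X in _ <= _ + _ * X]eq_bigr do rewrite natrX.
by rewrite lerD2l -ler_pdivlMl// mulrC.
Qed.

(** In every finite digraph the truncated star count lies below the truncated
    degree power.  The comparison passes to the limit at each level [K], then to the
    limit in [K]. *)
Lemma limit_mean_star_fin (s : {ffun 'I_m -> bool}) :
  (limit_mean (fun x => gdeg x ^ m)%N < +oo)%E ->
  (limit_mean (gemb (star_center s)) < +oo)%E.
Proof.
apply: le_lt_trans; have sc := @star_connected _ s.
have se := gtemb_exhausts (star_center s) sc; have de := gdeg_exhausts m.
apply: lee_cvg_to (limit_mean_exhausts se) (limit_mean_exhausts de) _.
apply: nearW => K.
have [sl sM _ _] := se; have [dl dM _ _] := de.
have [[M1 M1P] [M2 M2P]] := (sM K, dM K).
rewrite -(fineK (limit_mean_fin (sl K) M1P)) -(fineK (limit_mean_fin (dl K) M2P)) lee_fin.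
apply: ler_cvg_to (gmean_local_cvg (sl K) M1P) (gmean_local_cvg (dl K) M2P) _.
apply: nearW => n; apply: ler_mean => x.
by rewrite ler_nat gtemb_of// /gdeg_trunc gdeg_of card_star_thoms_le.
Qed.

(** Where the degree exceeds [K], the truncated star counts vanish, so the full
    star counts, which dominate the degree power there up to [4 ^ m], are part of
    the star tails. *)
Lemma deg_tails :
  (forall s : {ffun 'I_m -> bool},
    uniform_tails (gtemb (star_center s)) (gemb (star_center s))) ->
  uniform_tails (gdeg_trunc m) (fun x => gdeg x ^ m)%N.
Proof.
move=> tails; apply/uniform_tails_deg => e e0.
pose c : R := (4 ^ m * #|{ffun 'I_m -> bool}|)%:R.
have c0 : 0 < c by rewrite ltr0n muln_gt0 expn_gt0/= card_ffun expn_gt0 card_bool.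
have ec : 0 < e / c by rewrite divr_gt0.
have [k kP] := choice (fun s => tails s _ ec).
(* The first bound on [K] makes [deg_pow_le] applicable above [K]. *)
pose K := maxn (4 * m) (\max_s k s).
exists K => n.
have tail (s : {ffun 'I_m -> bool}) :
    gmean n (gemb (star_center s)) - gmean n (gtemb (star_center s) K) <= e / c.
  rewrite lerBlDl (le_trans (kP s n))// lerD2r.
  apply: ler_mean => x; rewrite ler_nat; apply: temb_mono; first exact: star_connected.
  by rewrite leq_max (leq_bigmax s) orbT.
apply: (@le_trans _ _ ((4 ^ m)%:R * \sum_(s : {ffun 'I_m -> bool})
    (gmean n (gemb (star_center s)) - gmean n (gtemb (star_center s) K)))); last first.
  rewrite (le_trans (ler_wpM2l _ (ler_sum _ (fun s _ => tail s))))//.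
  by rewrite sumr_const -(mulr_natr (e / c)) mulrCA -natrM -[X in _ * X]/c divfK// gt_eqF.
rewrite /gmean /mean /large_deg.
under eq_bigr do rewrite -mulrBl.
rewrite -mulr_suml mulrA ler_wpM2r ?invr_ge0// big_distrr /=.
under [leRHS]eq_bigr do rewrite -sumrB big_distrr /=.
rewrite exchange_big /=; apply: ler_sum => x _.
rewrite -big_distrr /=.
have diff (s : {ffun 'I_m -> bool}) : ((gemb (star_center s) (gstar_of R x))%:R -
    (gtemb (star_center s) K (gstar_of R x))%:R : R) =
    (#|homs_at (star_center s) x| - #|thoms_at (star_center s) K x|)%N%:R.
  rewrite gemb_of ?gtemb_of; [|exact: star_connected..].
  rewrite natrB//; apply: subset_leq_card; apply/fintype.subsetP => phi.
  by rewrite inE => /andP[].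
under eq_bigr do rewrite diff.
rewrite -natr_sum -natrM; case: ifP => [xK|_]; last by [].
rewrite -natrX ler_nat.
apply: leq_trans (deg_pow_le _) _.
  by apply: leq_trans (ltnW xK); exact: leq_maxl.
rewrite leq_mul2l; apply/orP; right; apply: leq_sum => s _.
have := card_star_thoms_le s K x; rewrite [(deg x <= K)%N]leqNgt xK /= leqn0 => /eqP ->.
by rewrite subn0.
Qed.

End degree_tails.

End exhaustion.

Theorem theorem5p3 (R : realType) (h : nat) (h2 : (2 <= h)%N)
    (G : nat -> digraph)
    (Goo : #|G n|%N @[n --> \oo] --> \oo)
    (d : nat -> measure_display) (T : forall n, measurableType (d n))
    (P : forall n, probability (T n) R)
    (v : forall n, T n -> G n)
    (v_unif : forall n, uniform_on (P n) (v n))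
    (d' : measure_display) (T' : measurableType d') (P' : probability T' R)
    (Gs : {RV P' >-> gstar_borel R})
    (Gcvg : cvg_in_distribution P (fun n w => gstar_of R (v n w)) P'
              (Gs : T' -> gstar R))
    (D := fun n w => (deg (v n w))%:R : R)
    (Ds := fun w => (gdeg (Gs w : gstar R))%:R : R)
    (Ds_int : ('E_P'[(fun w => Ds w ^+ h.-1)%R] < +oo)%E) :
  let i := 'E_(P n)[(fun w => D n w ^+ h.-1)%R]%E @[n --> \oo]
             --> 'E_P'[(fun w => Ds w ^+ h.-1)%R]%E in
  let ii := uniformly_integrable P (fun n w => D n w ^+ h.-1) in
  let iii := forall H : digraph, #|H| = h -> connected_digraph H ->
    forall r : H,
      ((emb H (G n))%:R / #|G n|%:R : R)%:E @[n --> \oo]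
        --> 'E_P'[(fun w => (gemb r (Gs w : gstar R))%:R)%R]%E in
  (i <-> ii) /\ (ii <-> iii).
Proof.
move=> i ii iii.
have m0 : (0 < h.-1)%N by rewrite -subn1 subn_gt0.
have hm : h.-1.+1 = h by rewrite prednK// (ltn_trans _ h2).
have nE : (fun n => 'E_(P n)[(fun w => D n w ^+ h.-1)%R]%E) =
    (fun n => (gmean G n (fun x : gstar R => gdeg x ^ h.-1)%N)%:E).
  apply/funext => n; rewrite -(expectation_uniform (v_unif n))//.
  by congr expectation; apply/funext => w /=; rewrite gdeg_of natrX.
have aE : 'E_P'[(fun w => Ds w ^+ h.-1)%R]%E =
    limit_mean Gs (fun x : gstar R => gdeg x ^ h.-1)%N.
  by congr expectation; apply/funext => w /=; rewrite natrX.
have embE (H : digraph) (r : H) : connected_digraph H ->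
    (fun n => ((emb H (G n))%:R / #|G n|%:R : R)%:E) =
    (fun n => (gmean G n (gemb (R := R) r))%:E).
  move=> Hc; apply/funext => n; congr (_ / _)%:E.
  by rewrite (emb_sum _ r) natr_sum; apply: eq_bigr => x _; rewrite gemb_of.
have a_fin := Ds_int; rewrite aE in a_fin.
have iiP := uniformly_integrable_deg v_unif m0.
split; split.
- move=> hi; apply/iiP.
  apply: (gmean_cvg_tails v_unif Gcvg (gdeg_exhausts R h.-1) a_fin).
  by move: hi; rewrite /i nE aE.
- move=> /iiP tails; rewrite /i nE aE.
  exact: (tails_gmean_cvg v_unif Gcvg (gdeg_exhausts R h.-1)).
- move=> /iiP tails H Hh Hc r; rewrite (embE _ r)//.
  apply: (tails_gmean_cvg v_unif Gcvg (gtemb_exhausts R r Hc)).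
  by apply: emb_tails tails; rewrite // Hh hm.
- move=> hiii; apply/iiP; apply: deg_tails => s.
  have sc := @star_connected _ s.
  apply: (gmean_cvg_tails v_unif Gcvg (gtemb_exhausts R (star_center s) sc)).
    exact: limit_mean_star_fin.
  by rewrite -embE//; apply: hiii; rewrite // card_star hm.
Qed.
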